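(* Let $b_0\ge 0$ and consider a birth--death process as in the context (state space $E=\{0,1,2,\dots\}$ if $b_0>0$, $E=\{1,2,\dots\}$ if $b_0=0$). Assume $\sum_{k\in E}\big(\frac{1}{\mu_k b_k}+\mu_k\big)=\infty$. Put $$\delta^{(1)}=\sup_{n\ge 1}\Big(\sum_{i=1}^n\frac{1}{\mu_i a_i}\Big)\Big(\sum_{j=n}^\infty\mu_j\Big),\qquad \delta^{(2)}=\sup_{n\in E}\Big(\sum_{i\in E,\,i\le n}\mu_i\Big)\Big(\sum_{j=n}^\infty\frac{1}{\mu_j b_j}\Big).$$ Then, whether $b_0>0$ or $b_0=0$, the exponential convergence rate $\alpha^*$ of the unique process is positive (1) if and only if $\delta^{(1)}<\infty$, in the case $\sum_{i\in E}\mu_i<\infty$; and (2) if and only if $\delta^{(2)}<\infty$, in the case $\sum_{i\in E}\mu_i=\infty$. More precisely, $\frac{1}{4\kappa}\le\alpha^*\le\frac1\kappa$, where, if $b_0>0$, $$\kappa^{-1}=\inf_{m>n\ge 0}\Big[\Big(\sum_{i=0}^n\mu_i\Big)^{-1}+\Big(\sum_{i=m}^\infty\mu_i\Big)^{-1}\Big]\Big(\sum_{j=n}^{m-1}\frac1{\mu_jb_j}\Big)^{-1},$$ and, if $b_0=0$, $$\kappa^{-1}=\inf_{m\ge n\ge 1}\Big[\Big(\sum_{i=1}^n\frac1{\mu_ia_i}\Big)^{-1}+\Big(\sum_{i=m}^\infty\frac1{\mu_ib_i}\Big)^{-1}\Big]\Big(\sum_{j=n}^{m}\mu_j\Big)^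{-1}.$$
   Context: Birth--death process: birth rates $b_i$ ($i\to i+1$) and death rates $a_i$ ($i\to i-1$), with $a_i>0$, $b_i>0$ for all $i\ge 1$. If $b_0>0$: the state space is $E=\{0,1,2,\dots\}$ (with $a_0=0$), $\mu_0=1$ and $\mu_n=\frac{b_0\cdots b_{n-1}}{a_1\cdots a_n}$ for $n\ge1$. If $b_0=0$: the state $0$ is absorbing; the process is considered on $E=\{1,2,\dots\}$, where $a_1>0$ acts as a killing rate at state $1$; $\mu_1=1$ and $\mu_n=\frac{b_1\cdots b_{n-1}}{a_2\cdots a_n}$ for $n\ge2$. Dirichlet form on $L^2(\mu)$: $D(f)=\sum_{i\ge1}\mu_ia_i(f_i-f_{i-1})^2$, where $f_0:=0$ in the case $b_0=0$. Under the assumption $\sum_{k\in E}(\frac1{\mu_kb_k}+\mu_k)=\infty$ there is exactly one $\mu$-symmetric process with these rates (the form with domain $\{f\in L^2(\mu):D(f)<\infty\}$ coincides with the closure of the finitely supported functions); this is ''the unique process''. Its transition probabilities are $p_{ij}(t)$, and $\pi_j:=\lim_{t\to\infty}p_{ij}(t)\ge0$, which exists and does not depend on $i\in E$. The exponential convergence rate is $$\alpha^*=\sup\{\alpha:\ |p_{ij}(t)-\pi_j|=O(e^{-\alpha t})\text{ as }t\to\infty\text{ for all }i,j\in E\}.$$ Conventions: $1/\infty=0$, $1/0=\infty$. *)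

(* Defs.v *)
From HB Require Import structures.
From mathcomp Require Import all_boot all_order all_algebra.
From mathcomp Require Import all_classical all_reals all_analysis.
Import Order.TTheory GRing.Theory Num.Theory.
Import numFieldNormedType.Exports.

Set Implicit Arguments.
Unset Strict Implicit.
Unset Printing Implicit Defensive.

Local Open Scope classical_set_scope.
Local Open Scope ring_scope.

Section BirthDeath.
Context {R : realType}.
Implicit Types (a b : nat -> R) (p : nat -> nat -> R -> R).

(* The state space is E = {n | bd_first b <= n}: it starts at 0 if b_0 is
   nonzero, and at 1 if b_0 = 0 (the state 0 is then absorbing). *)
Definition bd_first b : nat := if b 0 == 0 then 1%N else 0%N.

Definition bd_E b : set nat := [set n | (bd_first b <= n)%N].

(* With e := bd_first b, this is b_e ... b_{n-1} / (a_{e+1} ... a_n); it is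
   meaningful for n in E, and equals 1 at n = e. *)
Definition bd_mu a b (n : nat) : R :=
  (\prod_(bd_first b <= i < n) b i) /
  (\prod_((bd_first b).+1 <= i < n.+1) a i).

(* Rates on the whole of nat, to be used with a_0 = 0. When b_0 = 0 the row of
   the state 0 vanishes, and the jump 1 -> 0 at rate a_1 is the killing of the
   process on E = {1, 2, ...}. *)
Definition bd_rate a b (i j : nat) : R :=
  if j == i.+1 then b i
  else if i == j.+1 then a i
  else if i == j then - (a i + b i)
  else 0.

(* p i j t is p_ij(t); only times t >= 0 are meaningful. Total mass less than 1
   is allowed: the process may explode. *)
Record transition_function p : Prop := TransitionFunction {
  trans_ge0 : forall i j t, 0 <= t -> 0 <= p i j t ;
  trans_mass : forall i t, 0 <= t ->
    (\sum_(0 <= j <oo) (p i j t)%:E <= 1)%E ;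
  trans_id : forall i j, p i j 0 = (i == j)%:R ;
  trans_semigroup : forall i j s t, 0 <= s -> 0 <= t ->
    (\sum_(0 <= k <oo) (p i k s * p k j t)%:E)%E = (p i j (s + t))%:E }.

Definition has_rates (q : nat -> nat -> R) p : Prop :=
  forall i j, (p i j h - p i j 0) / h @[h --> 0^'+] --> q i j.

Definition symmetric_on (E : set nat) (mu : nat -> R) p : Prop :=
  forall i j t, E i -> E j -> 0 <= t -> mu i * p i j t = mu j * p j i t.

Definition bd_process a b p : Prop :=
  [/\ transition_function p,
      has_rates (bd_rate a b) p &
      symmetric_on (bd_E b) (bd_mu a b) p].

(* For a birth-death process the limit exists and depends only on j in E. *)
Definition limit_prob p (i j : nat) : R := lim (p i j t @[t --> +oo]).

Definition conv_rate (E : set nat) p : \bar R :=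
  ereal_sup [set alpha%:E | alpha in [set alpha : R |
    forall i j, E i -> E j ->
      exists C : R, \forall t \near +oo,
        `|p i j t - limit_prob p i j| <= C * expR (- alpha * t)]].

Local Open Scope ereal_scope.

Definition bd_delta1 a b : \bar R :=
  ereal_sup [set (\sum_(1 <= i < n.+1) (bd_mu a b i * a i)^-1)%R%:E *
                 \sum_(n <= j <oo) (bd_mu a b j)%:E
            | n in [set n | (1 <= n)%N]].

Definition bd_delta2 a b : \bar R :=
  ereal_sup [set (\sum_(bd_first b <= i < n.+1) bd_mu a b i)%R%:E *
                 \sum_(n <= j <oo) ((bd_mu a b j * b j)^-1)%R%:E
            | n in bd_E b].

(* The inverse on \bar R satisfies 0^-1 = +oo and +oo^-1 = 0. *)
Definition bd_kappaV_reflecting a b : \bar R :=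
  ereal_inf [set (((\sum_(0 <= i < nm.1.+1) bd_mu a b i)%R%:E)^-1 +
                  (\sum_(nm.2 <= i <oo) (bd_mu a b i)%:E)^-1) *
                 ((\sum_(nm.1 <= j < nm.2) (bd_mu a b j * b j)^-1)%R%:E)^-1
            | nm in [set nm : nat * nat | (0 <= nm.1 < nm.2)%N]].

Definition bd_kappaV_absorbing a b : \bar R :=
  ereal_inf [set (((\sum_(1 <= i < nm.1.+1) (bd_mu a b i * a i)^-1)%R%:E)^-1 +
                  (\sum_(nm.2 <= i <oo) ((bd_mu a b i * b i)^-1)%R%:E)^-1) *
                 ((\sum_(nm.1 <= j < nm.2.+1) bd_mu a b j)%R%:E)^-1
            | nm in [set nm : nat * nat | (1 <= nm.1 <= nm.2)%N]].

Definition bd_kappa a b : \bar R :=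
  (if b 0%N == 0%R then bd_kappaV_absorbing a b
   else bd_kappaV_reflecting a b)^-1.

End BirthDeath.

(* Main.v *)
(** Symmetry and the convergence of the transition function give, for finitely
    supported f, a finite sum phi(t) = <f, P_t f> which is nonnegative,
    nonincreasing and log-convex up to its limit L, and phi(2t) = |P_t f|^2.

    Upper bound. If all p_ij converge at rate alpha, log-convexity improves
    phi(t) - L = O(e^{-alpha t}) to phi(t) - L <= (phi(0) - L) e^{-alpha t}; the
    derivative at 0 then gives alpha (|f|^2 - L) <= D(f), and L is at most the
    squared mean of f. Piecewise harmonic test functions f yield alpha <= 1/kappa.

    Lower bound. By Fatou the decay of phi at 2t is at least D(P_t f), the
    maximal form, so a Poincare inequality for the maximal domain is enough. In the
    absorbing and null cases it is a two-sided Hardy inequality with constant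
    4 kappa. It is proved by cutting the total mass at a point x, possibly inside
    an atom, such that the part to the left of x satisfies the one-sided
    condition with Dirichlet boundary at 0, and the part to the right of x the one with
    Dirichlet boundary at infinity; the divergence of sum (1/(mu b) + mu)
    forces square-integrable functions of finite energy to vanish at infinity
    whenever this boundary is seen. In the ergodic case the same Hardy inequality
    is applied to the flux h_k = sum_{i <= k} mu_i g_i, exchanging the roles
    of mu and 1/(mu b). *)

Require Import Defs.
From mathcomp Require Import all_boot all_order all_algebra.
From mathcomp Require Import all_classical all_reals all_analysis.
From mathcomp Require Import ring lra.
Import Order.TTheory GRing.Theory Num.Theory.
Import numFieldNormedType.Exports.

Set Implicit Arguments.
Unset Strict Implicit.
Unset Printing Implicit Defensive.

Local Open Scope classical_set_scope.
Local Open Scope ring_scope.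

(** * Hardy inequalities on a half-line *)

Section Hardy.
Context {R : realType}.

(** No generator or spectral theorem enters: what they would say about P_t is read off the finite
    sums [phi]. The upper bound therefore differentiates phi only at time 0, for finitely supported
    f. At later times the lower bound uses only a one-sided inequality that survives truncation, and
    the strict inequality lam * K < 1 leaves the room for it. Absorption is treated as killing:
    after a shift of indices both state spaces become nat, and [a 0] tells the two cases apart. The
    4 is the classical Hardy constant. It arises on a single edge, as the discrete trace of 2hh'/s +
    (h^2/s)' = 4h'^2 - (2h' - h/s)^2, where s is the resistance to the boundary, and it telescopes
    along the half-line. The divergence hypothesis acts a second time in the ergodic case: there it
    makes sum 1/(mu b) infinite, hence the process conservative, so that the mean of P_t f is
    preserved. *)

Lemma hardy_edge (U K rho r G H : R) : 0 < rho -> 0 < r -> 0 <= U ->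
  U * (rho + r) <= K ->
  U * (G ^+ 2 - H ^+ 2) + K * (G ^+ 2 / (rho + r) - H ^+ 2 / rho) <=
    4 * K * ((G - H) ^+ 2 / r).
Proof.
move=> rho0 r0 U0 UK.
have s0 : 0 < rho + r by rewrite addr_gt0.
have K0 : 0 <= K by apply: le_trans UK; rewrite mulr_ge0// ltW.
set X := G ^+ 2 - H ^+ 2.
set Y := G ^+ 2 / (rho + r) - H ^+ 2 / rho.
set Z := (G - H) ^+ 2 / r.
have p0 : 0 < r * rho * (rho + r) by rewrite !mulr_gt0.
have Z0 : 0 <= Z by rewrite divr_ge0 ?sqr_ge0// ltW.
have YZ : Y <= Z.
  rewrite -subr_ge0.
  have -> : Z - Y = (rho * (G - H) - r * H) ^+ 2 / (r * rho * (rho + r)).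
    by rewrite /Z /Y; field; rewrite ?gt_eqF.
  by rewrite divr_ge0 ?sqr_ge0// ltW.
(* The squared term of the remainder vanishes when G - H = r H / (2 rho), the increment of a
   square-root profile; the other term is negligible when r is small against rho. *)
have XYZ : X / (rho + r) + Y <= 4 * Z.
  rewrite -subr_ge0.
  have -> : 4 * Z - (X / (rho + r) + Y) =
    ((2 * rho * (G - H) - r * H) ^+ 2 + 2 * rho * r * (G - H) ^+ 2)
      / (r * rho * (rho + r)).
    by rewrite /Z /Y /X; field; rewrite ?gt_eqF.
  apply: divr_ge0; last exact: ltW.
  by apply: addr_ge0; [exact: sqr_ge0 | apply: mulr_ge0; [rewrite !mulr_ge0// ltW | exact: sqr_ge0]].
(* The bound U <= K / (rho + r) helps only for X > 0; otherwise U X is dropped and Y <= Z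
   suffices. *)
have [X0|X0] := leP X 0.
  have : U * X <= 0 by rewrite mulr_ge0_le0.
  have : K * Y <= K * Z by rewrite ler_wpM2l.
  have : 0 <= K * Z by rewrite mulr_ge0.
  by lra.
have : U * X <= K * (X / (rho + r)).
  by rewrite mulrA ler_pdivlMr// mulrAC ler_wpM2r// ltW.
have := ler_wpM2l K0 XYZ; rewrite mulrDr.
by lra.
Qed.


(* With S_k = x - (w_0 + ... + w_{k-1}), summation by parts turns the left-hand side
   into the sum of S_k (h_k^2 - h_{k-1}^2). Edges with S_k >= 0 are compared
   with the resistance Rs to the left end, the others with the resistance T to
   infinity; [hardy_edge] telescopes on both sides, and the last term is
   the remaining potential. *)
Lemma hardy_core (w r Rs T h e : nat -> R) (K x : R) :
  (forall k, 0 <= w k) -> (forall k, 0 < r k.+1) -> (forall k, 0 < Rs k) ->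
  (forall k, Rs k.+1 = Rs k + r k.+1) -> 0 <= K -> 0 <= x ->
  (forall k, 0 <= x - \sum_(i < k) w i -> (x - \sum_(i < k) w i) * Rs k <= K) ->
  (forall k, x < \sum_(i < k) w i ->
    [/\ 0 < T k.+1, T k = T k.+1 + r k & (\sum_(i < k) w i - x) * T k <= K]) ->
  (forall k, e k.+1 = (h k.+1 - h k) ^+ 2 / r k.+1) ->
  0 <= e 0%N -> (x = 0 /\ 0 < w 0%N) \/ h 0%N ^+ 2 / Rs 0%N <= e 0%N ->
  forall N, \sum_(i < N.+1) w i * h i ^+ 2 +
    (x - \sum_(i < N.+1) w i) * h N ^+ 2 +
    (if 0 <= x - \sum_(i < N.+1) w i then K * (h N ^+ 2 / Rs N)
     else - (K * (h N ^+ 2 / T N.+1))) <= 4 * K * \sum_(i < N.+1) e i.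
Proof.
move=> w0 r0 Rs0 RsS K0 x0 HL HR eS e0 base; elim=> [|N IH].
  rewrite !big_ord1; set S1 := x - w 0%N.
  have T1 : S1 < 0 -> 0 <= K * (h 0%N ^+ 2 / T 1%N).
    move=> S10; have [|T2 TE _] := HR 1%N.
      by rewrite big_ord1 -subr_lt0.
    by rewrite mulr_ge0// divr_ge0 ?sqr_ge0// TE addr_ge0 ?ltW.
  have Ke : 0 <= K * e 0%N by rewrite mulr_ge0.
  (* With x = 0 and a positive first weight, every edge lies to the right of the cut: this is the
     reflecting boundary at 0. *)
  case: base => [[x00 w00]|base].
    have S10 : S1 < 0 by rewrite /S1 x00 sub0r oppr_lt0.
    by rewrite (lt_geF S10); move: (T1 S10); rewrite /S1 x00; lra.
  have xK : x * h 0%N ^+ 2 <= K * (h 0%N ^+ 2 / Rs 0%N).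
    have := HL 0%N; rewrite big_ord0 subr0 => /(_ x0) xR.
    by rewrite mulrA ler_pdivlMr// mulrAC ler_wpM2r ?sqr_ge0.
  have Kb : K * (h 0%N ^+ 2 / Rs 0%N) <= K * e 0%N by rewrite ler_wpM2l.
  have [S10|S10] := leP 0 S1; last move: (T1 S10); rewrite /S1; lra.
have E2 : forall u : nat -> R, \sum_(i < N.+2) u i = \sum_(i < N.+1) u i + u N.+1.
  by move=> u; rewrite big_ord_recr.
rewrite (E2 w) (E2 e) (E2 (fun i => w i * h i ^+ 2)) /=.
set W := \sum_(i < N.+1) w i in IH *.
set A := \sum_(i < N.+1) w i * h i ^+ 2 in IH *.
set B := \sum_(i < N.+1) e i in IH *.
have [SN|SN] := leP 0 (x - W).
  rewrite SN in IH.
  have := hardy_edge (h N.+1) (h N) (Rs0 N) (r0 N) SN.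
  rewrite -RsS -eS => edge.
  have {}edge : (x - W) * (h N.+1 ^+ 2 - h N ^+ 2) +
      K * (h N.+1 ^+ 2 / Rs N.+1 - h N ^+ 2 / Rs N) <= 4 * K * e N.+1.
    by apply: edge; apply: HL.
  have [S1|S1] := leP 0 (x - (W + w N.+1)); first by lra.
  have [|T2 TE _] := HR N.+2; first by rewrite E2 -subr_lt0.
  have : 0 <= K * (h N.+1 ^+ 2 / T N.+2).
    by rewrite mulr_ge0// divr_ge0 ?sqr_ge0// TE addr_ge0 ?ltW.
  have : 0 <= K * (h N.+1 ^+ 2 / Rs N.+1).
    by rewrite mulr_ge0// divr_ge0 ?sqr_ge0// ltW.
  by lra.
have S1 : x - (W + w N.+1) < 0 by move: (w0 N.+1); lra.
rewrite (lt_geF SN) in IH; rewrite (lt_geF S1).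
have [|T2 TE TK] := HR N.+1; first by rewrite -/W -subr_lt0.
(* Right of the cut, the edge is read backwards, from infinity towards the cut. *)
have := hardy_edge (h N) (h N.+1) T2 (r0 N) _ _.
move=> /(_ (W - x) K); rewrite -TE.
have -> : (h N - h N.+1) ^+ 2 = (h N.+1 - h N) ^+ 2 by ring.
rewrite -eS => edge.
have {}edge : (W - x) * (h N ^+ 2 - h N.+1 ^+ 2) +
      K * (h N ^+ 2 / T N.+1 - h N.+1 ^+ 2 / T N.+2) <= 4 * K * e N.+1.
  by apply: edge => //; lra.
by lra.
Qed.

Lemma hardy_left (w r Rs h e : nat -> R) (K x : R) :
  (forall k, 0 <= w k) -> (forall k, 0 < r k.+1) -> (forall k, 0 < Rs k) ->
  (forall k, Rs k.+1 = Rs k + r k.+1) -> 0 <= K ->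
  (forall k, 0 <= x - \sum_(i < k) w i) ->
  (forall k, (x - \sum_(i < k) w i) * Rs k <= K) ->
  (forall k, e k.+1 = (h k.+1 - h k) ^+ 2 / r k.+1) ->
  h 0%N ^+ 2 / Rs 0%N <= e 0%N ->
  forall N, \sum_(i < N.+1) w i * h i ^+ 2 <= 4 * K * \sum_(i < N.+1) e i.
Proof.
move=> w0 r0 Rs0 RsS K0 S0 HL eS base N.
have x0 : 0 <= x by have := S0 0%N; rewrite big_ord0 subr0.
have e0 : 0 <= e 0%N by apply: le_trans base; rewrite divr_ge0 ?sqr_ge0// ltW.
(* S_k never becomes negative, which makes the conditions on T vacuous: 0 is a placeholder. *)
have := @hardy_core w r Rs (fun=> 0) h e K x w0 r0 Rs0 RsS K0 x0
  (fun k _ => HL k) _ eS e0 (or_intror base) N.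
rewrite S0 => H; apply: le_trans (H _).
  have : 0 <= K * (h N ^+ 2 / Rs N) by rewrite mulr_ge0// divr_ge0 ?sqr_ge0// ltW.
  have : 0 <= (x - \sum_(i < N.+1) w i) * h N ^+ 2 by rewrite mulr_ge0 ?sqr_ge0.
  by lra.
by move=> k; rewrite -subr_lt0 ltNge S0.
Qed.

(** Induction step of Cauchy-Schwarz along a path; the cross term 2 A d is split by AM-GM. *)
Lemma cauchy_step (A P Q d r : R) : 0 <= P -> 0 <= Q -> 0 < r ->
  A ^+ 2 <= P * Q -> (A + d) ^+ 2 <= (P + r) * (Q + d ^+ 2 / r).
Proof.
move=> P0 Q0 r0 APQ; set q := d ^+ 2 / r.
have dE : d ^+ 2 = q * r by rewrite /q mulfVK ?gt_eqF.
have q0 : 0 <= q by rewrite divr_ge0 ?sqr_ge0// ltW.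
have : (A * d) ^+ 2 <= (P * q) * (r * Q).
  rewrite exprMn dE; have -> : P * q * (r * Q) = P * Q * (q * r) by ring.
  by rewrite ler_wpM2r// mulr_ge0// ltW.
move=> H; have Pq : 0 <= P * q by rewrite mulr_ge0.
have rQ : 0 <= r * Q by rewrite mulr_ge0// ltW.
have : 2 * (A * d) <= P * q + r * Q.
  have : (2 * (A * d)) ^+ 2 <= (P * q + r * Q) ^+ 2.
    have : 0 <= (P * q - r * Q) ^+ 2 by rewrite sqr_ge0.
    by move: H; set u := P * q; set v := r * Q; set z := A * d; nra.
  move=> H2; apply: le_trans (ler_norm _) _.
  by rewrite -(ger0_norm (addr_ge0 Pq rQ)) -ler_sqr ?nnegrE// !real_normK ?num_real.
by rewrite sqrrD dE mulr2n; lra.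
Qed.

Lemma increment_bound (r h e : nat -> R) :
  (forall k, 0 < r k.+1) ->
  (forall k, e k.+1 = (h k.+1 - h k) ^+ 2 / r k.+1) ->
  forall N m, (h (N + m)%N - h N) ^+ 2 <=
    (\sum_(i < m) r (N + i).+1) * (\sum_(i < m) e (N + i).+1).
Proof.
move=> r0 eS N; elim=> [|m IH]; first by rewrite addn0 subrr expr0n !big_ord0 mul0r.
rewrite !big_ord_recr /= addnS eS.
have -> : h (N + m).+1 - h N = (h (N + m)%N - h N) + (h (N + m).+1 - h (N + m)%N).
  by ring.
apply: cauchy_step => //; apply: sumr_ge0 => i _; first exact: ltW.
by rewrite eS divr_ge0 ?sqr_ge0// ltW.
Qed.

Lemma hardy_right (w r Rs T h e : nat -> R) (K x E : R) :
  (forall k, 0 <= w k) -> (forall k, 0 < r k.+1) -> (forall k, 0 < Rs k) ->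
  (forall k, Rs k.+1 = Rs k + r k.+1) -> 0 <= K -> 0 <= x ->
  (forall k, 0 < T k) -> (forall k, T k.+1 = T k.+2 + r k.+1) ->
  (forall k, 0 <= x - \sum_(i < k) w i -> (x - \sum_(i < k) w i) * Rs k <= K) ->
  (forall k, (\sum_(i < k.+1) w i - x) * T k.+1 <= K) ->
  (forall k, e k.+1 = (h k.+1 - h k) ^+ 2 / r k.+1) ->
  0 <= e 0%N -> (x = 0 /\ 0 < w 0%N) \/ h 0%N ^+ 2 / Rs 0%N <= e 0%N ->
  h n @[n --> \oo] --> 0 -> (forall N, \sum_(i < N) e i <= E) ->
  forall N, \sum_(i < N.+1) w i * h i ^+ 2 <= 4 * K * E.
Proof.
move=> w0 r0 Rs0 RsS K0 x0 T0 TS HL HR eS e0 base hc HE N.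
have := @hardy_core w r Rs T h e K x w0 r0 Rs0 RsS K0 x0 HL _ eS e0 base N.
set W := \sum_(i < N.+1) w i; set A := \sum_(i < N.+1) _; set B := \sum_(i < N.+1) _.
move=> H; have {}H : A + (x - W) * h N ^+ 2 +
     (if 0 <= x - W then K * (h N ^+ 2 / Rs N) else - (K * (h N ^+ 2 / T N.+1))) <=
     4 * K * B.
  apply: H => -[|k]; first by rewrite big_ord0 ltNge x0.
  by move=> _; split; [exact: T0 | exact: TS | exact: HR].
have BE : B <= E by exact: HE.
have KBE : K * B <= K * E by rewrite ler_wpM2l.
move: H; case: ifPn => [SN H|_ H].
  have : 0 <= K * (h N ^+ 2 / Rs N) by rewrite mulr_ge0// divr_ge0 ?sqr_ge0// ltW.
  have : 0 <= (x - W) * h N ^+ 2 by rewrite mulr_ge0 ?sqr_ge0.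
  by lra.
(* Since h vanishes at infinity, the energy E - B left beyond N controls h_N. The two leftover terms
   of the core inequality then cost at most K (E - B) each, which fits into 4 K (E - B). *)
have hT : h N ^+ 2 <= T N.+1 * (E - B).
  have lim : (h (N + m)%N - h N) ^+ 2 @[m --> \oo] --> h N ^+ 2.
    have lim1 : h (N + m)%N - h N @[m --> \oo] --> 0 - h N.
      apply: cvgB; last exact: cvg_cst.
      by move: hc; rewrite -(cvg_shiftn N); under eq_fun do rewrite addnC.
    have -> : h N ^+ 2 = (0 - h N) * (0 - h N) by ring.
    by under eq_fun do rewrite expr2; exact: cvgM.
  apply: (cvgr_to_le lim); apply: nearW => m.
  apply: le_trans (increment_bound r0 eS N m) _.
  have TT : T N.+1 = \sum_(i < m) r (N + i).+1 + T (N + m).+1.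
    elim: m => [|m IH]; first by rewrite big_ord0 addn0 add0r.
    by rewrite IH big_ord_recr /= TS addnS; ring.
  apply: ler_pM.
  - by apply: sumr_ge0 => i _; exact: ltW.
  - by apply: sumr_ge0 => i _; rewrite eS divr_ge0 ?sqr_ge0// ltW.
  - by rewrite TT lerDl ltW.
  rewrite lerBrDl; apply: le_trans (HE (N.+1 + m)%N).
  by rewrite big_split_ord /=.
have K1 : K * (h N ^+ 2 / T N.+1) <= K * (E - B).
  by rewrite ler_wpM2l// ler_pdivrMr// mulrC.
have : (W - x) * h N ^+ 2 <= K * (h N ^+ 2 / T N.+1).
  by rewrite mulrA ler_pdivlMr// mulrAC ler_wpM2r ?sqr_ge0//; exact: HR.
by lra.
Qed.

End Hardy.

(** * Symmetric sub-Markov semigroups on the integers *)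

Section Limits.
Context {R : realType}.

Lemma cvg_sum_ord {T : Type} (F : set_system T) {FF : Filter F} n
    (u : nat -> T -> R) (l : nat -> R) :
  (forall k, (k < n)%N -> u k x @[x --> F] --> l k) ->
  (\sum_(k < n) u k x) @[x --> F] --> \sum_(k < n) l k.
Proof.
elim: n => [|n IH] ul.
  by under eq_fun do rewrite big_ord0; rewrite big_ord0; exact: cvg_cst.
under eq_fun do rewrite big_ord_recr /=; rewrite big_ord_recr /=.
by apply: cvgD; [apply: IH => k kn; apply: ul; rewrite ltnW | exact: ul].
Qed.

Lemma ler_sum_ord (u v : nat -> R) m n : (m <= n)%N ->
  (forall i, 0 <= v i) -> (forall i, u i <= v i) ->
  \sum_(i < m) u i <= \sum_(i < n) v i.
Proof.
move=> mn v0 uv; rewrite -(subnKC mn) big_split_ord /= -[leLHS]addr0.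
by apply: lerD; [exact: ler_sum | exact: sumr_ge0].
Qed.

Lemma series_ge (u : nat -> R) l : (forall k, 0 <= u k) ->
  (\sum_(k < n) u k) @[n --> \oo] --> l -> forall n, \sum_(k < n) u k <= l.
Proof.
move=> u0 ul n; apply: (cvgr_to_ge ul); near=> m.
have nm : (n <= m)%N by near: m; exact: nbhs_infty_ge.
by rewrite -(subnKC nm) big_split_ord /= lerDl sumr_ge0.
Unshelve. all: by end_near. Qed.

(** Square truncations are invariant under exchange of the two indices, as the symmetrisation in
    [phi_drop] requires; nonnegativity makes them exhaust the double series. *)
Lemma square_sum_cvg (c : nat -> nat -> R) (A : nat -> R) (l : R) :
  (forall i k, 0 <= c i k) ->
  (forall i, (\sum_(k < n) c i k) @[n --> \oo] --> A i) ->
  (\sum_(i < n) A i) @[n --> \oo] --> l ->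
  (\sum_(i < n) \sum_(k < n) c i k) @[n --> \oo] --> l.
Proof.
move=> c0 cA Al; have cA' i n : \sum_(k < n) c i k <= A i by apply: series_ge.
have A0 i : 0 <= A i by move: (cA' i 0%N); rewrite big_ord0.
have Al' n : \sum_(i < n) A i <= l by apply: series_ge.
apply/cvgrPdist_le => e e0.
have e20 : 0 < e / 2 by rewrite divr_gt0.
have [I _ HI] : \forall n \near \oo, `|l - \sum_(i < n) A i| <= e / 2.
  by move/cvgrPdist_le : Al; apply.
have {}HI : l - e / 2 <= \sum_(i < I) A i.
  by have := HI I (leqnn _); rewrite ler_norml => /andP[_]; lra.
have cI : (\sum_(i < I) \sum_(k < n) c i k) @[n --> \oo] --> \sum_(i < I) A i.
  by apply: (@cvg_sum_ord _ _ _ _ (fun i n => \sum_(k < n) c i k)) => i _.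
have cI2 : \forall n \near \oo,
    `|\sum_(i < I) A i - \sum_(i < I) \sum_(k < n) c i k| <= e / 2.
  by move/cvgrPdist_le : cI; apply.
near=> n.
have In : (I <= n)%N by near: n; exact: nbhs_infty_ge.
have : `|\sum_(i < I) A i - \sum_(i < I) \sum_(k < n) c i k| <= e / 2 by near: n.
rewrite ler_norml => /andP[_ H1].
have H2 : \sum_(i < n) \sum_(k < n) c i k <= l.
  by apply: le_trans (Al' n); apply: ler_sum => i _; exact: cA'.
have H3 : \sum_(i < I) \sum_(k < n) c i k <= \sum_(i < n) \sum_(k < n) c i k.
  apply: (@ler_sum_ord (fun i => \sum_(k < n) c i k)
    (fun i => \sum_(k < n) c i k)) => // i.
  exact: sumr_ge0.
by rewrite ger0_norm ?subr_ge0//; lra.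
Unshelve. all: by end_near. Qed.

End Limits.

(** * The quadratic form of P_t on finitely supported functions *)

Section Semigroup.
Context {R : realType}.

(* [a 0] is the killing rate of the state 0, and [z t] a lower bound for the
   probability of having been killed by time t when starting from 0. *)
Record bd_semigroup (w a b : nat -> R) (q : nat -> nat -> R -> R) (z : R -> R) : Prop :=
  BDSemigroup {
  w_gt0 : forall i, 0 < w i ;
  a0_ge0 : 0 <= a 0%N ;
  aS_gt0 : forall i, 0 < a i.+1 ;
  b_gt0 : forall i, 0 < b i ;
  w_balance : forall i, w i.+1 * a i.+1 = w i * b i ;
  q_ge0 : forall i j t, 0 <= t -> 0 <= q i j t ;
  q_mass : forall i n t, 0 <= t -> \sum_(j < n) q i j t <= 1 ;
  q_id : forall i j, q i j 0 = (i == j)%:R ;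
  q_semigroup : forall i j s t, 0 <= s -> 0 <= t ->
    (\sum_(k < n) q i k s * q k j t) @[n --> \oo] --> q i j (s + t) ;
  q_sym : forall i j t, 0 <= t -> w i * q i j t = w j * q j i t ;
  q_rate : forall i j, (q i j h - q i j 0) / h @[h --> 0^'+] --> bd_rate a b i j ;
  z_ge0 : forall t, 0 <= t -> 0 <= z t ;
  z_mass : forall n t, 0 <= t -> \sum_(j < n) q 0 j t + z t <= 1 ;
  z_rate : z h / h @[h --> 0^'+] --> a 0%N }.

Context {w a b : nat -> R} {q : nat -> nat -> R -> R} {z : R -> R}.
Hypothesis H : bd_semigroup w a b q z.

Definition Pt (f : nat -> R) N (t : R) i := \sum_(j < N) q i j t * f j.

(* <f, P_t f> in L^2(w), for f supported in [0, N). *)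
Definition phi (f : nat -> R) N (t : R) :=
  \sum_(j < N) \sum_(k < N) w j * f j * f k * q j k t.

(** Symmetry turns w_i q_ij into w_j q_ji; Chapman-Kolmogorov then applies to each of the finitely
    many pairs in the support. *)
Lemma PtM_cvg f N s t : 0 <= s -> 0 <= t ->
  (\sum_(i < n) w i * Pt f N s i * Pt f N t i) @[n --> \oo] --> phi f N (s + t).
Proof.
move=> s0 t0.
have E n : \sum_(i < n) w i * Pt f N s i * Pt f N t i =
    \sum_(j < N) \sum_(k < N) w j * f j * f k * \sum_(i < n) q j i s * q i k t.
  under [RHS]eq_bigr => j _ do under eq_bigr => k _ do rewrite mulr_sumr.
  under [RHS]eq_bigr => j _ do rewrite exchange_big.
  rewrite [RHS]exchange_big; apply: eq_bigr => i _ /=.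
  rewrite /Pt -mulrA mulr_suml mulr_sumr; apply: eq_bigr => j _.
  rewrite !mulr_sumr; apply: eq_bigr => k _.
  have -> : w i * (q i j s * f j * (q i k t * f k)) =
    w i * q i j s * f j * (q i k t * f k) by ring.
  by rewrite (q_sym H)//; ring.
under eq_fun do rewrite E.
rewrite /phi; apply: (@cvg_sum_ord _ _ _ _ _
  (fun j n => \sum_(k < N) w j * f j * f k * \sum_(i < n) q j i s * q i k t)
  (fun j => \sum_(k < N) w j * f j * f k * q j k (s + t))) => j _.
apply: (@cvg_sum_ord _ _ _ _ _
  (fun k n => w j * f j * f k * \sum_(i < n) q j i s * q i k t)
  (fun k => w j * f j * f k * q j k (s + t))) => k _.
by apply: cvgM; [exact: cvg_cst | exact: (q_semigroup H)].
Qed.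

(** This is the squared norm of x P_r f + y P_s f + v P_t f. It replaces the spectral representation
    as the source of convexity and log-convexity of phi. *)
Lemma phi_psd f N (x y v r s t : R) : 0 <= r -> 0 <= s -> 0 <= t ->
  0 <= x ^+ 2 * phi f N (r + r) + y ^+ 2 * phi f N (s + s) + v ^+ 2 * phi f N (t + t)
    + 2 * x * y * phi f N (r + s) + 2 * x * v * phi f N (r + t)
    + 2 * y * v * phi f N (s + t).
Proof.
move=> r0 s0 t0.
have L : \sum_(i < n) w i * (x * Pt f N r i + y * Pt f N s i + v * Pt f N t i) ^+ 2
   @[n --> \oo] --> x ^+ 2 * phi f N (r + r) + y ^+ 2 * phi f N (s + s)
    + v ^+ 2 * phi f N (t + t)
    + 2 * x * y * phi f N (r + s) + 2 * x * v * phi f N (r + t)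
    + 2 * y * v * phi f N (s + t).
  pose S u u' n := \sum_(i < n) w i * Pt f N u i * Pt f N u' i.
  have E n : \sum_(i < n) w i * (x * Pt f N r i + y * Pt f N s i + v * Pt f N t i) ^+ 2
    = x ^+ 2 * S r r n + y ^+ 2 * S s s n + v ^+ 2 * S t t n
      + 2 * x * y * S r s n + 2 * x * v * S r t n + 2 * y * v * S s t n.
    by rewrite /S !mulr_sumr -!big_split /=; apply: eq_bigr => i _; ring.
  under eq_fun do rewrite E.
  by do ![apply: cvgD]; apply: cvgM; try exact: cvg_cst; exact: PtM_cvg.
apply: (cvgr_to_ge L); apply: nearW => n; apply: sumr_ge0 => i _.
by rewrite mulr_ge0 ?sqr_ge0// ltW// (w_gt0 H).
Qed.

Lemma phi_ge0 f N t : 0 <= t -> 0 <= phi f N t.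
Proof.
move=> t0; have t20 : 0 <= t / 2 by rewrite divr_ge0.
have := @phi_psd f N 1 0 0 _ _ _ t20 t20 t20.
by rewrite -splitr; congr (_ <= _); ring.
Qed.

Lemma Pt_sqr_le f N t n : 0 <= t ->
  \sum_(i < n) w i * Pt f N t i ^+ 2 <= phi f N (t + t).
Proof.
move=> t0; have := @PtM_cvg f N _ _ t0 t0.
under eq_fun do under eq_bigr do rewrite -mulrA -expr2.
move=> L; apply: (@series_ge _ (fun i => w i * Pt f N t i ^+ 2) _ _ L).
by move=> k; rewrite mulr_ge0 ?sqr_ge0// ltW// (w_gt0 H).
Qed.

Lemma PtMq_cvg f N s t : 0 <= s -> 0 <= t ->
  (\sum_(i < n) \sum_(k < n) w i * q i k s * Pt f N t i * Pt f N t k) @[n --> \oo]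
   --> phi f N (t + t + s).
Proof.
move=> s0 t0.
have E n : \sum_(i < n) \sum_(k < n) w i * q i k s * Pt f N t i * Pt f N t k =
    \sum_(j < N) \sum_(l < N) w j * f j * f l *
      \sum_(i < n) \sum_(k < n) q j i t * (q i k s * q k l t).
  under [RHS]eq_bigr => j _ do under eq_bigr => l _ do rewrite mulr_sumr.
  under [RHS]eq_bigr => j _ do rewrite exchange_big.
  rewrite [RHS]exchange_big; apply: eq_bigr => i _ /=.
  under [RHS]eq_bigr => j _ do under eq_bigr => l _ do rewrite mulr_sumr.
  under [RHS]eq_bigr => j _ do rewrite exchange_big.
  rewrite [RHS]exchange_big; apply: eq_bigr => k _ /=.
  rewrite /Pt -mulrA mulr_suml mulr_sumr; apply: eq_bigr => j _.
  rewrite !mulr_sumr; apply: eq_bigr => l _.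
  have -> : w i * q i k s * (q i j t * f j * (q k l t * f l)) =
    w i * q i j t * q i k s * f j * (q k l t * f l) by ring.
  by rewrite (q_sym H)//; ring.
under eq_fun do rewrite E.
rewrite /phi; apply: (@cvg_sum_ord _ _ _ _ _ (fun j n => \sum_(l < N) w j * f j * f l *
  \sum_(i < n) \sum_(k < n) q j i t * (q i k s * q k l t))
  (fun j => \sum_(l < N) w j * f j * f l * q j l (t + t + s))) => j _.
apply: (@cvg_sum_ord _ _ _ _ _ (fun l n => w j * f j * f l *
  \sum_(i < n) \sum_(k < n) q j i t * (q i k s * q k l t))
  (fun l => w j * f j * f l * q j l (t + t + s))) => l _.
apply: cvgM; first exact: cvg_cst.
apply: (@square_sum_cvg _ (fun i k => q j i t * (q i k s * q k l t))
  (fun i => q j i t * q i l (s + t))).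
- by move=> i k; rewrite !mulr_ge0 ?(q_ge0 H).
- move=> i; under eq_fun do rewrite -mulr_sumr.
  by apply: cvgM; [exact: cvg_cst | exact: (q_semigroup H)].
- have -> : t + t + s = t + (s + t) by ring.
  by apply: (q_semigroup H) => //; rewrite addr_ge0.
Qed.

(* The finite identity underlying the Beurling-Deny form of
   <g, g> - <g, P_s g>, truncated to a J x J square. *)
Lemma phi_drop f N (d : nat -> R) s t J : 0 <= s -> 0 <= t ->
  (forall i, 0 <= d i) -> (forall i n, \sum_(k < n) q i k s + d i <= 1) ->
  2^-1 * \sum_(i < J) \sum_(k < J) w i * q i k s * (Pt f N t i - Pt f N t k) ^+ 2
    + \sum_(i < J) w i * d i * Pt f N t i ^+ 2
  <= phi f N (t + t) - phi f N (t + t + s).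
Proof.
move=> s0 t0 d0 dq; set g := Pt f N t.
have E n : \sum_(i < n) w i * g i * g i
    - \sum_(i < n) \sum_(k < n) w i * q i k s * g i * g k =
    2^-1 * (\sum_(i < n) \sum_(k < n) w i * q i k s * (g i - g k) ^+ 2)
    + \sum_(i < n) w i * (1 - \sum_(k < n) q i k s) * g i ^+ 2.
  have X : \sum_(i < n) \sum_(k < n) w i * q i k s * g k ^+ 2 =
     \sum_(i < n) \sum_(k < n) w i * q i k s * g i ^+ 2.
    rewrite exchange_big; apply: eq_bigr => i _; apply: eq_bigr => k _.
    by rewrite /= (q_sym H).
  have Y : \sum_(i < n) \sum_(k < n) w i * q i k s * (g i - g k) ^+ 2 =
     \sum_(i < n) \sum_(k < n) w i * q i k s * g i ^+ 2 +
     \sum_(i < n) \sum_(k < n) w i * q i k s * g k ^+ 2 -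
     2 * \sum_(i < n) \sum_(k < n) w i * q i k s * g i * g k.
    rewrite mulr_sumr -big_split /= -sumrB; apply: eq_bigr => i _.
    rewrite mulr_sumr -big_split /= -sumrB; apply: eq_bigr => k _; ring.
  have Z : \sum_(i < n) w i * (1 - \sum_(k < n) q i k s) * g i ^+ 2 =
     \sum_(i < n) w i * g i * g i -
     \sum_(i < n) \sum_(k < n) w i * q i k s * g i ^+ 2.
    rewrite -sumrB; apply: eq_bigr => i _.
    by rewrite -mulr_suml -mulr_sumr; ring.
  by rewrite Y X Z; field.
have L : \sum_(i < n) w i * g i * g i
    - \sum_(i < n) \sum_(k < n) w i * q i k s * g i * g k @[n --> \oo]
    --> phi f N (t + t) - phi f N (t + t + s).
  by apply: cvgB; [exact: PtM_cvg | exact: PtMq_cvg].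
apply: (cvgr_to_ge L); near=> n; rewrite E.
have Jn : (J <= n)%N by near: n; exact: nbhs_infty_ge.
have w0 := w_gt0 H; have q0 := q_ge0 H.
apply: lerD.
  have c0 i k : 0 <= w i * q i k s * (g i - g k) ^+ 2.
    by apply: mulr_ge0; [rewrite mulr_ge0 ?q0// ltW | exact: sqr_ge0].
  rewrite ler_wpM2l ?invr_ge0//.
  apply: (@ler_sum_ord _ (fun i => \sum_(k < J) w i * q i k s * (g i - g k) ^+ 2)
    (fun i => \sum_(k < n) w i * q i k s * (g i - g k) ^+ 2)) => // i.
    exact: sumr_ge0.
  by apply: (@ler_sum_ord _ (fun k => w i * q i k s * (g i - g k) ^+ 2)
    (fun k => w i * q i k s * (g i - g k) ^+ 2)).
apply: (@ler_sum_ord _ (fun i => w i * d i * g i ^+ 2)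
  (fun i => w i * (1 - \sum_(k < n) q i k s) * g i ^+ 2)) => // i.
  apply: mulr_ge0; last exact: sqr_ge0.
  by rewrite mulr_ge0 ?(ltW (w0 _))// subr_ge0 (q_mass H).
apply: ler_wpM2r; first exact: sqr_ge0.
by apply: ler_wpM2l; [exact: ltW | move: (dq i n); lra].
Unshelve. all: by end_near. Qed.

End Semigroup.
Arguments Pt {R} q f N t i.
Arguments phi {R} w q f N t.
Arguments q_rate {R w a b q z} _ i j.

(** * Energy *)

Section Energy.
Context {R : realType}.
Context {w a b : nat -> R} {q : nat -> nat -> R -> R} {z : R -> R}.
Hypothesis H : bd_semigroup w a b q z.

Lemma square_sumS (c : nat -> nat -> R) n :
  \sum_(i < n.+1) \sum_(k < n.+1) c i k =
  \sum_(i < n) \sum_(k < n) c i k + \sum_(i < n) c i n + \sum_(i < n) c n i + c n n.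
Proof.
rewrite big_ord_recr /= big_ord_recr /= addrA; congr (_ + _ + _).
by rewrite -big_split /=; apply: eq_bigr => i _; rewrite big_ord_recr.
Qed.

(** Longer jumps can be discarded: their probability is of smaller order in time, so only
    neighbouring pairs survive in the Dirichlet form. *)
Lemma sum_edges_le (c : nat -> nat -> R) n :
  (forall i k, 0 <= c i k) -> (forall i k, c i k = c k i) ->
  2 * \sum_(i < n) c i i.+1 <= \sum_(i < n.+1) \sum_(k < n.+1) c i k.
Proof.
move=> c0 cs; elim: n => [|n IH].
  by rewrite big_ord0 mulr0 sumr_ge0// => i _; apply: sumr_ge0.
rewrite (square_sumS c n.+1) [in leLHS]big_ord_recr /=.
rewrite (big_ord_recr n (fun i : 'I_n.+1 => c i n.+1)) (big_ord_recr n (fun i : 'I_n.+1 => c n.+1 i)) /=.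
have s1 : 0 <= \sum_(i < n) c i n.+1 by apply: sumr_ge0.
have s2 : 0 <= \sum_(i < n) c n.+1 i by apply: sumr_ge0.
have := c0 n.+1 n.+1; rewrite (cs n.+1 n).
by move: IH; lra.
Qed.

(** Divided by s, the left-hand side tends to the truncated Dirichlet form of P_t f as s -> 0. At a
    fixed s > 0 it forces neighbouring values of P_t f together as t -> oo. *)
Lemma phi_edges f N s t n : 0 <= s -> 0 <= t ->
  \sum_(i < n) w i * q i i.+1 s * (Pt q f N t i - Pt q f N t i.+1) ^+ 2
    + w 0%N * z s * Pt q f N t 0%N ^+ 2
  <= phi w q f N (t + t) - phi w q f N (t + t + s).
Proof.
move=> s0 t0.
set g := Pt q f N t.
apply: le_trans (@phi_drop _ _ _ _ _ _ H f N
  (fun i => if i is 0%N then z s else 0) _ _ n.+1 s0 t0 _ _); first last.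
- by case=> [|i] m; [exact: (z_mass H) | rewrite addr0 (q_mass H)].
- by case=> //; exact: (z_ge0 H).
apply: lerD.
  rewrite -(ler_pM2l (ltr0n R 2)) mulrA mulfV// mul1r.
  apply: (@sum_edges_le (fun i k => w i * q i k s * (g i - g k) ^+ 2) n) => i k.
    by apply: mulr_ge0; [rewrite mulr_ge0 ?(q_ge0 H)// ltW// (w_gt0 H) | exact: sqr_ge0].
  by rewrite (q_sym H)//; ring.
rewrite big_ord_recl /= big1 ?addr0// => i _.
by rewrite mulr0 mul0r.
Qed.

Lemma phi_nonincreasing f N s t : 0 <= s -> 0 <= t -> phi w q f N (t + s) <= phi w q f N t.
Proof.
move=> s0 t0; have t20 : 0 <= t / 2 by rewrite divr_ge0.
have := @phi_edges f N s _ 0 s0 t20; rewrite -splitr big_ord0 add0r => E.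
rewrite -subr_ge0; apply: le_trans E; apply: mulr_ge0; last exact: sqr_ge0.
by rewrite mulr_ge0 ?(z_ge0 H)// ltW// (w_gt0 H).
Qed.

Lemma phi_is_cvg f N : exists l : R, phi w q f N t @[t --> +oo] --> l.
Proof.
(* Monotonicity is known for nonnegative times only, hence the clamping. *)
pose F t := - phi w q f N (Num.max 0 t).
have max0 (t : R) : 0 <= Num.max 0 t by rewrite le_max lexx.
have Fnd : nondecreasing_fun F.
  move=> x y xy; rewrite lerN2.
  have -> : Num.max 0 y = Num.max 0 x + (Num.max 0 y - Num.max 0 x) by ring.
  apply: phi_nonincreasing => //; rewrite subr_ge0.
  by rewrite ge_max !le_max lexx xy orbT.
have Fub : has_ubound (range F).
  by exists 0 => _ [x _ <-]; rewrite /F oppr_le0 (phi_ge0 H).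
exists (- sup (range F)).
have FE : \forall t \near +oo, - F t = phi w q f N t.
  near=> t; have t0 : 0 <= t by near: t; apply: nbhs_pinfty_ge; rewrite num_real.
  by rewrite /F opprK max_r.
apply: cvg_trans; first exact: (near_eq_cvg FE).
by apply: cvgN; exact: nondecreasing_cvgr.
Unshelve. all: by end_near. Qed.

Lemma sum_delta (u : nat -> R) N i : (i < N)%N -> \sum_(k < N) (k == i :> nat)%:R * u k = u i.
Proof.
move=> iN; rewrite (bigD1 (Ordinal iN)) //= eqxx mul1r big1 ?addr0// => k.
by rewrite -val_eqE /= => /negbTE ->; rewrite mul0r.
Qed.

Definition delta2 (x y : R) (i j k : nat) : R := x * (k == i)%:R + y * (k == j)%:R.

Lemma phi_delta2 x y i j N t : 0 <= t -> (i < N)%N -> (j < N)%N ->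
  phi w q (delta2 x y i j) N t =
    x ^+ 2 * (w i * q i i t) + 2 * x * y * (w i * q i j t) + y ^+ 2 * (w j * q j j t).
Proof.
move=> t0 iN jN.
have E l : \sum_(k < N) delta2 x y i j k * q l k t = x * q l i t + y * q l j t.
  rewrite -(sum_delta (fun k => q l k t) iN) -(sum_delta (fun k => q l k t) jN).
  rewrite !mulr_sumr -big_split /=; apply: eq_bigr => k _.
  by rewrite /delta2; ring.
rewrite /phi.
under eq_bigr => l _.
  under eq_bigr => k _ do rewrite -mulrA.
  by rewrite -mulr_sumr E; over.
transitivity (x * (w i * (x * q i i t + y * q i j t)) + y * (w j * (x * q j i t + y * q j j t))).
  rewrite -(sum_delta (fun l => w l * (x * q l i t + y * q l j t)) iN).
  rewrite -(sum_delta (fun l => w l * (x * q l i t + y * q l j t)) jN).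
  rewrite !mulr_sumr -big_split /=; apply: eq_bigr => k _.
  by rewrite /delta2; ring.
have -> : 2 * x * y * (w i * q i j t) = x * y * (w i * q i j t) + x * y * (w j * q j i t).
  by rewrite (q_sym H j i)//; ring.
by ring.
Qed.

(** Polarisation: convergence and decay of the quadratic forms pass to each transition
    probability. *)
Lemma q_polar i j N t : 0 <= t -> (i < N)%N -> (j < N)%N ->
  q i j t = (phi w q (delta2 1 1 i j) N t - phi w q (delta2 1 0 i j) N t
    - phi w q (delta2 0 1 i j) N t) / (2 * w i).
Proof.
move=> t0 iN jN; rewrite !phi_delta2//.
by have := w_gt0 H i => wi; field; rewrite gt_eqF.
Qed.

Lemma q_is_cvg i j : exists l : R, q i j t @[t --> +oo] --> l.
Proof.
pose N := (maxn i j).+1.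
have iN : (i < N)%N by rewrite ltnS leq_maxl.
have jN : (j < N)%N by rewrite ltnS leq_maxr.
have [l1 h1] := phi_is_cvg (delta2 1 1 i j) N.
have [l2 h2] := phi_is_cvg (delta2 1 0 i j) N.
have [l3 h3] := phi_is_cvg (delta2 0 1 i j) N.
exists ((l1 - l2 - l3) / (2 * w i)).
have FE : \forall t \near +oo, (phi w q (delta2 1 1 i j) N t - phi w q (delta2 1 0 i j) N t
    - phi w q (delta2 0 1 i j) N t) / (2 * w i) = q i j t.
  near=> t; have t0 : 0 <= t by near: t; apply: nbhs_pinfty_ge; rewrite num_real.
  by rewrite -q_polar.
apply: cvg_trans; first exact: (near_eq_cvg FE).
apply: cvgM; last exact: cvg_cst.
by apply: cvgB => //; apply: cvgB.
Unshelve. all: by end_near. Qed.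

Lemma small_time_gt0 (F : R -> R) (l : R) : 0 < l -> F h / h @[h --> 0^'+] --> l ->
  exists2 s, 0 < s & 0 < F s.
Proof.
move=> l0 Fl; near (0 : R)^'+ => s.
have s0 : 0 < s by near: s; exact: nbhs_right_gt.
exists s => //; suff : 0 < F s / s by rewrite pmulr_lgt0 ?invr_gt0.
by near: s; apply: (cvgr_gt _ Fl).
Unshelve. all: by end_near. Qed.

Lemma phi_cvg_shift f N (L : R) : phi w q f N t @[t --> +oo] --> L ->
  forall r u : R, 0 < r -> phi w q f N (r * t + u) @[t --> +oo] --> L.
Proof.
move=> phiL r u r0.
apply: (cvg_comp (fun t => r * t + u) (phi w q f N) _ phiL).
apply/cvgryPge => A; near=> t.
have : (A - u) / r <= t by near: t; apply: nbhs_pinfty_ge; rewrite num_real.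
by rewrite ler_pdivrMr//; lra.
Unshelve. all: by end_near. Qed.

(* P_t f converges to a constant c, because the energy lost between t and t + s
   tends to 0; c = 0 if there is killing. *)
Lemma phi_lim f N : exists c : R,
  [/\ phi w q f N t @[t --> +oo] --> c * \sum_(j < N) w j * f j,
      forall n, c ^+ 2 * \sum_(i < n) w i <= c * \sum_(j < N) w j * f j &
      0 < a 0%N -> c = 0].
Proof.
have [L phiL] := phi_is_cvg f N.
have [l ql] : {l : nat -> nat -> R & forall i j, q i j t @[t --> +oo] --> l i j}.
  have [l ql] := choice (fun ij : nat * nat => q_is_cvg ij.1 ij.2).
  by exists (fun i j => l (i, j)) => i j; exact: (ql (i, j)).
pose g i := \sum_(j < N) l i j * f j.
have gl i : Pt q f N t i @[t --> +oo] --> g i.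
  rewrite /g /Pt; apply: (@cvg_sum_ord _ _ _ _ _ (fun j t => q i j t * f j)
    (fun j => l i j * f j)) => j _.
  by apply: cvgM; [exact: ql | exact: cvg_cst].
have phi_shift u : phi w q f N (t + t + u) @[t --> +oo] --> L.
  have := phi_cvg_shift phiL u (ltr0Sn R 1 : 0 < 2).
  by under eq_fun do rewrite mulr_natl mulr2n.
have drop0 s : phi w q f N (t + t) - phi w q f N (t + t + s) @[t --> +oo] --> 0.
  rewrite -(subrr L); apply: cvgB => //.
  by have := phi_shift 0; under eq_fun do rewrite addr0.
have kill (c : R) (G : R -> R) (l' : R) : 0 < c -> G t @[t --> +oo] --> l' ->
    (exists2 s, 0 <= s & \forall t \near +oo,
      c * G t ^+ 2 <= phi w q f N (t + t) - phi w q f N (t + t + s)) -> l' = 0.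
  move=> c0 Gl [s s0 Gs].
  have : c * l' ^+ 2 <= 0.
    apply: ler_cvg_to (drop0 s) Gs.
    by apply: cvgM; [exact: cvg_cst | under eq_fun do rewrite expr2; rewrite expr2; exact: cvgM].
  rewrite pmulr_rle0// => l'0.
  by apply/eqP; rewrite -sqrf_eq0 eq_le l'0 sqr_ge0.
have w0 := w_gt0 H.
have wq i s : 0 <= s -> 0 <= w i * q i i.+1 s.
  by move=> s0; rewrite mulr_ge0 ?(q_ge0 H)// ltW.
have gS i : g i = g i.+1.
  apply/eqP; rewrite -subr_eq0; apply/eqP.
  have [s s0 qs] : exists2 s, 0 < s & 0 < q i i.+1 s.
    apply: (small_time_gt0 (b_gt0 H i)).
    have := q_rate H i i.+1; rewrite /bd_rate eqxx (q_id H).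
    have -> : (i == i.+1) = false by apply/negbTE; rewrite neq_ltn ltnSn.
    by under eq_fun do rewrite subr0.
  apply: (kill (w i * q i i.+1 s) (fun t => Pt q f N t i - Pt q f N t i.+1)).
  - by rewrite mulr_gt0.
  - by apply: cvgB.
  exists s; first exact: ltW.
  near=> t.
  have t0 : 0 <= t by near: t; apply: nbhs_pinfty_ge; rewrite num_real.
  apply: le_trans (phi_edges f N i.+1 (ltW s0) t0).
  rewrite big_ord_recr /= -addrA addrCA lerDl addr_ge0//.
    apply: sumr_ge0 => k _; apply: mulr_ge0; last exact: sqr_ge0.
    by apply: wq; exact: ltW.
  apply: mulr_ge0; last exact: sqr_ge0.
  by rewrite mulr_ge0 ?(z_ge0 H)// ltW.
have gE i : g i = g 0%N by elim: i => [//|i IH]; rewrite -gS.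
have LE : L = g 0%N * \sum_(j < N) w j * f j.
  apply: (cvg_unique _ phiL) => //.
  rewrite mulr_sumr /phi; apply: (@cvg_sum_ord _ _ _ _ _
     (fun j t => \sum_(k < N) w j * f j * f k * q j k t)
     (fun j => g 0%N * (w j * f j))) => j _.
  rewrite -(gE j) /g mulr_suml; apply: (@cvg_sum_ord _ _ _ _ _
     (fun k t => w j * f j * f k * q j k t)
     (fun k => l j k * f k * (w j * f j))) => k _.
  have -> : l j k * f k * (w j * f j) = w j * f j * f k * l j k by ring.
  by apply: cvgM; [exact: cvg_cst | exact: ql].
exists (g 0%N); split; first by rewrite -LE.
  (* Each truncation of |P_t f|^2 is at most phi(2t); letting t -> oo bounds the squared norm of the
     constant c by L, so c = 0 when w has infinite mass. *)
  move=> n; rewrite -LE.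
  have phi2 : phi w q f N (t + t) @[t --> +oo] --> L.
    by have := phi_shift 0; under eq_fun do rewrite addr0.
  have S : \sum_(i < n) w i * Pt q f N t i ^+ 2 @[t --> +oo] --> g 0%N ^+ 2 * \sum_(i < n) w i.
    rewrite mulr_sumr; apply: (@cvg_sum_ord _ _ _ _ _
      (fun i t => w i * Pt q f N t i ^+ 2) (fun i => g 0%N ^+ 2 * w i)) => i _.
    rewrite mulrC -(gE i); apply: cvgM; first exact: cvg_cst.
    by under eq_fun do rewrite expr2; rewrite expr2; apply: cvgM.
  apply: ler_cvg_to S phi2 _; near=> t; apply: (Pt_sqr_le H).
  by near: t; apply: nbhs_pinfty_ge; rewrite num_real.
move=> a0.
have [s s0 zs] := small_time_gt0 a0 (z_rate H).
apply: (kill (w 0%N * z s) (fun t => Pt q f N t 0%N)).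
- by rewrite mulr_gt0.
- exact: gl.
exists s; first exact: ltW.
near=> t.
have t0 : 0 <= t by near: t; apply: nbhs_pinfty_ge; rewrite num_real.
by have := phi_edges f N 0 (ltW s0) t0; rewrite big_ord0 add0r.
Unshelve. all: by end_near. Qed.

(** Edges are indexed by their lower end. The term at 0 is the edge to the cemetery: the i = 1 term
    of D with f_0 = 0, once the absorbing case is shifted by one. *)
Definition Dform (w a b f : nat -> R) N :=
  w 0%N * a 0%N * f 0%N ^+ 2 + \sum_(i < N) w i * b i * (f i - f i.+1) ^+ 2.

(** The boundary term comes from the edge from n to n+1, through which the truncated rate matrix
    still loses mass; it is the energy of that edge when f vanishes at n+1. *)
Lemma rate_form (f : nat -> R) n :
  - \sum_(j < n.+1) \sum_(k < n.+1) w j * f j * f k * bd_rate a b j k =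
    Dform w a b f n + w n * b n * f n ^+ 2.
Proof.
rewrite /Dform; elim: n => [|n IH].
  by rewrite !big_ord1 big_ord0 /bd_rate /=; ring.
rewrite (square_sumS (fun j k => w j * f j * f k * bd_rate a b j k) n.+1).
rewrite (big_ord_recr n (fun i : 'I_n.+1 => w i * f i * f n.+1 * bd_rate a b i n.+1)) /=.
rewrite (big_ord_recr n (fun i : 'I_n.+1 => w n.+1 * f n.+1 * f i * bd_rate a b n.+1 i)) /=.
rewrite [in RHS]big_ord_recr /=.
have -> : \sum_(i < n) w i * f i * f n.+1 * bd_rate a b i n.+1 = 0.
  apply: big1 => i _; rewrite /bd_rate eqSS [n == _]eq_sym (ltn_eqF (ltn_ord i)).
  rewrite !ltn_eqF ?mulr0//; first exact: ltn_trans (ltn_ord i) (ltnSn n).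
  by rewrite ltnS ltnW// (ltn_trans (ltn_ord i)).
have -> : \sum_(i < n) w n.+1 * f n.+1 * f i * bd_rate a b n.+1 i = 0.
  apply: big1 => i _; rewrite /bd_rate eqSS (gtn_eqF (ltn_ord i)).
  by rewrite ltn_eqF ?gtn_eqF ?mulr0// (ltn_trans (ltn_ord i)).
rewrite /bd_rate !eqxx /= [n == n.+2]ltn_eqF// [n.+1 == n.+2]ltn_eqF//.
have B1 : w n.+1 * f n.+1 * f n * a n.+1 = w n * b n * f n * f n.+1.
  by have := w_balance H n => B; rewrite -B; ring.
have B2 : w n.+1 * a n.+1 * f n.+1 ^+ 2 = w n * b n * f n.+1 ^+ 2.
  by rewrite (w_balance H).
rewrite B1 mulrN mulrDr.
by move: IH B2; rewrite !expr2; lra.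
Qed.

Lemma phi_deriv f N : (forall i, (N <= i)%N -> f i = 0) ->
  (phi w q f N 0 - phi w q f N h) / h @[h --> 0^'+] --> Dform w a b f N.
Proof.
case: N => [|n] f0.
  rewrite /Dform big_ord0 f0// expr0n mulr0 addr0 /phi.
  by under eq_fun do rewrite !big_ord0 subr0 mul0r; exact: cvg_cst.
have -> : Dform w a b f n.+1 = Dform w a b f n + w n * b n * f n ^+ 2.
  by rewrite /Dform big_ord_recr /= (f0 n.+1)// subr0 addrA.
rewrite -rate_form.
have E h : (phi w q f n.+1 0 - phi w q f n.+1 h) / h =
  - \sum_(j < n.+1) \sum_(k < n.+1) w j * f j * f k * ((q j k h - q j k 0) / h).
  rewrite /phi -sumrB mulr_suml -sumrN; apply: eq_bigr => j _.
  rewrite -sumrB mulr_suml -sumrN; apply: eq_bigr => k _; ring.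
under eq_fun do rewrite E.
apply: cvgN; apply: (@cvg_sum_ord _ _ _ _ _
  (fun j h => \sum_(k < n.+1) w j * f j * f k * ((q j k h - q j k 0) / h))
  (fun j => \sum_(k < n.+1) w j * f j * f k * bd_rate a b j k)) => j _.
apply: (@cvg_sum_ord _ _ _ _ _
  (fun k h => w j * f j * f k * ((q j k h - q j k 0) / h))
  (fun k => w j * f j * f k * bd_rate a b j k)) => k _.
by apply: cvgM; [exact: cvg_cst | exact: (q_rate H)].
Qed.

(** phi is midpoint convex, so halving the time step increases the quotients (phi(0) - phi(u)) / u
    towards their limit at 0; dyadic fractions of s suffice. *)
Lemma phi_drop_le f N s : (forall i, (N <= i)%N -> f i = 0) -> 0 < s ->
  phi w q f N 0 - phi w q f N s <= s * Dform w a b f N.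
Proof.
move=> f0 s0.
have half u : 0 <= u -> phi w q f N 0 - phi w q f N u <=
    2 * (phi w q f N 0 - phi w q f N (u / 2)).
  move=> u0; have u20 : 0 <= u / 2 by rewrite divr_ge0.
  have := @phi_psd _ _ _ _ _ _ H f N 1 (-1) 0 _ _ _ (lexx 0) u20 u20.
  by rewrite addr0 add0r -splitr; lra.
have sn0 n : 0 < s / 2 ^+ n by rewrite divr_gt0 ?exprn_gt0.
have iter n : phi w q f N 0 - phi w q f N s <=
   s * ((phi w q f N 0 - phi w q f N (s / 2 ^+ n)) / (s / 2 ^+ n)).
  suff : phi w q f N 0 - phi w q f N s <=
      2 ^+ n * (phi w q f N 0 - phi w q f N (s / 2 ^+ n)).
    move=> /le_trans; apply; rewrite le_eqVlt; apply/orP; left; apply/eqP.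
    by field; rewrite !gt_eqF ?exprn_gt0.
  elim: n => [|n IH]; first by rewrite expr0 divr1 mul1r.
  have -> : s / 2 ^+ n.+1 = s / 2 ^+ n / 2 by rewrite exprSr invfM mulrA.
  by apply: le_trans IH _; rewrite exprSr -mulrA ler_wpM2l ?exprn_ge0// half// ltW.
have sl : s / 2 ^+ n @[n --> \oo] --> 0.
  rewrite -[X in _ --> X](mulr0 s); apply: cvgM; first exact: cvg_cst.
  under eq_fun do rewrite -exprVn.
  by apply: cvg_expr; rewrite ger0_norm ?invf_lt1 ?ltr1n.
have L := (cvg_at_rightP _ _ _).1 (phi_deriv f0) _ (conj sn0 sl).
have L' : s * ((phi w q f N 0 - phi w q f N (s / 2 ^+ n)) / (s / 2 ^+ n))
    @[n --> \oo] --> s * Dform w a b f N.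
  by apply: cvgM; [exact: cvg_cst | exact: L].
apply: (cvgr_to_ge L').
by apply: nearW => n; exact: iter.
Qed.

End Energy.

(** * Exponential decay controls the energy *)

Section Decay.
Context {R : realType}.
Implicit Types (G : R -> R) (alpha : R).

Definition exp_bounded alpha G :=
  exists C : R, \forall t \near +oo, `|G t| <= C * expR (- alpha * t).

Lemma exp_bounded_le alpha G1 G2 : exp_bounded alpha G2 ->
  (\forall t \near +oo, `|G1 t| <= `|G2 t|) -> exp_bounded alpha G1.
Proof.
move=> [C GC] G12; exists C; near=> t.
by apply: (@le_trans _ _ `|G2 t|); near: t.
Unshelve. all: by end_near. Qed.

Lemma exp_boundedZ alpha G (c : R) : exp_bounded alpha G ->
  exp_bounded alpha (fun t => c * G t).
Proof.
move=> [C GC]; exists (`|c| * C); near=> t.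
by rewrite normrM -mulrA ler_wpM2l//; near: t.
Unshelve. all: by end_near. Qed.

Lemma exp_boundedD alpha G1 G2 : exp_bounded alpha G1 -> exp_bounded alpha G2 ->
  exp_bounded alpha (fun t => G1 t + G2 t).
Proof.
move=> [C1 GC1] [C2 GC2]; exists (C1 + C2); near=> t.
by apply: le_trans (ler_normD _ _) _; rewrite mulrDl lerD//; near: t.
Unshelve. all: by end_near. Qed.

Lemma exp_bounded_sum alpha n (G : nat -> R -> R) :
  (forall k, (k < n)%N -> exp_bounded alpha (G k)) ->
  exp_bounded alpha (fun t => \sum_(k < n) G k t).
Proof.
elim: n => [|n IH] GC.
  by exists 0; near=> t; rewrite big_ord0 normr0 mul0r.
have [|C HC] := @exp_boundedD alpha _ _ (IH _) (GC n (leqnn _)).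
  by move=> k kn; apply: GC; rewrite ltnW.
by exists C; near=> t; rewrite big_ord_recr /=; near: t.
Unshelve. all: by end_near. Qed.

Definition decays (q : nat -> nat -> R -> R) alpha :=
  forall i j, exp_bounded alpha (fun t => q i j t - limit_prob q i j).

Lemma power_bounded_le1 (Y C : R) : (\forall n \near \oo, Y ^+ (2 ^ n) <= C) -> Y <= 1.
Proof.
move=> YC; rewrite leNgt; apply/negP => Y1.
have bern m : 1 + m%:R * (Y - 1) <= Y ^+ m.
  elim: m => [|m IH]; first by rewrite mul0r addr0 expr0.
  rewrite exprS; apply: le_trans (ler_wpM2l (ltW (lt_trans ltr01 Y1)) IH).
  have m0 : 0 <= m%:R :> R by [].
  rewrite -natr1 -subr_ge0.
  have -> : Y * (1 + m%:R * (Y - 1)) - (1 + (m%:R + 1) * (Y - 1)) = m%:R * (Y - 1) ^+ 2 by ring.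
  by rewrite mulr_ge0 ?sqr_ge0.
have [n _ nC] := YC.
pose m := maxn n (Num.bound `|C / (Y - 1)|).
have := nC m (leq_maxl _ _); apply/negP; rewrite -ltNge.
apply: lt_le_trans (bern _).
have Y10 : 0 < Y - 1 by rewrite subr_gt0.
have : C < m%:R * (Y - 1).
  rewrite -ltr_pdivrMr//; apply: le_lt_trans (ler_norm _) _.
  apply: lt_le_trans (archi_boundP (normr_ge0 _)) _; rewrite ler_nat.
  exact: leq_maxr.
have : m%:R * (Y - 1) <= (2 ^ m)%:R * (Y - 1).
  by apply: ler_wpM2r; [exact: ltW | rewrite ler_nat ltnW// ltn_expl].
by lra.
Qed.

Context {w a b : nat -> R} {q : nat -> nat -> R -> R} {z : R -> R}.
Hypothesis H : bd_semigroup w a b q z.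

Lemma limit_prob_cvg i j : q i j t @[t --> +oo] --> limit_prob q i j.
Proof.
have [l ql] := q_is_cvg H i j.
by rewrite /limit_prob (cvg_lim _ ql).
Qed.

Lemma phi0 f N : phi w q f N 0 = \sum_(i < N) w i * f i ^+ 2.
Proof.
rewrite /phi; apply: eq_bigr => j _.
under eq_bigr => k _ do rewrite (q_id H) mulrC eq_sym.
by rewrite (sum_delta (fun k => w j * f j * f k))//; ring.
Qed.

Lemma phi_decay f N alpha (L : R) : decays q alpha -> phi w q f N t @[t --> +oo] --> L ->
  exp_bounded alpha (fun t => phi w q f N t - L).
Proof.
move=> dec phiL.
have LE : L = \sum_(j < N) \sum_(k < N) w j * f j * f k * limit_prob q j k.
  apply: (cvg_unique _ phiL) => //.
  rewrite /phi; apply: (@cvg_sum_ord _ _ _ _ _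
     (fun j t => \sum_(k < N) w j * f j * f k * q j k t)
     (fun j => \sum_(k < N) w j * f j * f k * limit_prob q j k)) => j _.
  apply: (@cvg_sum_ord _ _ _ _ _
     (fun k t => w j * f j * f k * q j k t)
     (fun k => w j * f j * f k * limit_prob q j k)) => k _.
  by apply: cvgM; [exact: cvg_cst | exact: limit_prob_cvg].
have -> : (fun t => phi w q f N t - L) = (fun t => \sum_(j < N) \sum_(k < N)
    w j * f j * f k * (q j k t - limit_prob q j k)).
  apply/funext => t; rewrite LE /phi -sumrB; apply: eq_bigr => j _.
  by rewrite -sumrB; apply: eq_bigr => k _; ring.
apply: (@exp_bounded_sum _ _ (fun j t => \sum_(k < N)
    w j * f j * f k * (q j k t - limit_prob q j k))) => j _.
apply: (@exp_bounded_sum _ _ (fun k t =>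
    w j * f j * f k * (q j k t - limit_prob q j k))) => k _.
exact: exp_boundedZ.
Qed.

(* The psd form [phi_psd] at the times 0, t, T with T -> +oo. *)
Lemma chi_log_convex f N (L t x y : R) : phi w q f N t @[t --> +oo] --> L -> 0 <= t ->
  0 <= x ^+ 2 * (phi w q f N 0 - L) + 2 * x * y * (phi w q f N t - L)
       + y ^+ 2 * (phi w q f N (t + t) - L).
Proof.
move=> phiL t0.
have L1 := phi_cvg_shift phiL 0 (ltr01 : 0 < 1).
have L2 := phi_cvg_shift phiL 0 (ltr0Sn R 1 : 0 < 2).
have L3 := phi_cvg_shift phiL t (ltr01 : 0 < 1).
(* The third weight -x-y makes the weights sum to 0; this is what subtracts L once T -> oo. *)
have E : x ^+ 2 * phi w q f N 0 + y ^+ 2 * phi w q f N (t + t)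
    + (- x - y) ^+ 2 * phi w q f N (2 * T + 0) + 2 * x * y * phi w q f N t
    + 2 * x * (- x - y) * phi w q f N (1 * T + 0)
    + 2 * y * (- x - y) * phi w q f N (1 * T + t) @[T --> +oo] -->
    x ^+ 2 * phi w q f N 0 + y ^+ 2 * phi w q f N (t + t)
    + (- x - y) ^+ 2 * L + 2 * x * y * phi w q f N t
    + 2 * x * (- x - y) * L + 2 * y * (- x - y) * L.
  by do ![apply: cvgD]; apply: cvgM => //; exact: cvg_cst.
have -> : x ^+ 2 * (phi w q f N 0 - L) + 2 * x * y * (phi w q f N t - L)
       + y ^+ 2 * (phi w q f N (t + t) - L) =
    x ^+ 2 * phi w q f N 0 + y ^+ 2 * phi w q f N (t + t)
    + (- x - y) ^+ 2 * L + 2 * x * y * phi w q f N t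
    + 2 * x * (- x - y) * L + 2 * y * (- x - y) * L by ring.
apply: (cvgr_to_ge E); near=> T.
have T0 : 0 <= T by near: T; apply: nbhs_pinfty_ge; rewrite num_real.
have := @phi_psd _ _ _ _ _ _ H f N x y (- x - y) _ _ _ (lexx 0) t0 T0.
have -> : 2 * T + 0 = T + T by ring.
have -> : 1 * T + 0 = T by ring.
have -> : 1 * T + t = t + T by ring.
by rewrite addr0 !add0r; congr (_ <= _); ring.
Unshelve. all: by end_near. Qed.

(* By [chi_log_convex], v = (phi - L) / (phi 0 - L) satisfies v(s)^(2^n) <= v(2^n s),
   so that v(s) <= e^{-alpha s} whatever the constants in [decays]. *)
Lemma decay_energy f N alpha : 0 < alpha -> decays q alpha ->
  (forall i, (N <= i)%N -> f i = 0) ->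
  exists2 c : R, 0 < a 0%N -> c = 0 & forall M, (N <= M)%N ->
    alpha * \sum_(i < M) w i * (f i - c) ^+ 2 <= Dform w a b f N.
Proof.
move=> alpha0 dec f0; have [c [phiL cM ca]] := phi_lim H f N.
exists c => // M NM; set L := c * _ in phiL cM.
pose chi t := phi w q f N t - L.
have chi0 t : 0 <= t -> 0 <= chi t.
  move=> t0; rewrite subr_ge0; apply: (cvgr_to_le phiL); near=> u.
  have tu : t <= u by near: u; apply: nbhs_pinfty_ge; rewrite num_real.
  by rewrite -(subrKC t u); apply: (phi_nonincreasing H); rewrite ?subr_ge0.
(* As c sum w f = L, expanding the square gives |f|^2 - 2 L + c^2 sum w, and c^2 sum w <= L by
   [phi_lim]. *)
have chiM : \sum_(i < M) w i * (f i - c) ^+ 2 <= chi 0.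
  have Nsum (u : nat -> R) : \sum_(i < M) u i * f i = \sum_(i < N) u i * f i.
    rewrite -(subnKC NM) big_split_ord /= [X in _ + X]big1 ?addr0// => i _.
    by rewrite f0 ?leq_addr// mulr0.
  have -> : \sum_(i < M) w i * (f i - c) ^+ 2 =
    \sum_(i < M) (w i * f i) * f i - 2 * (c * \sum_(i < M) w i * f i)
      + c ^+ 2 * \sum_(i < M) w i.
    by rewrite !mulr_sumr -sumrB -big_split /=; apply: eq_bigr => i _; ring.
  rewrite !Nsum (Nsum (fun i => w i * f i)) -/L /chi phi0.
  have -> : \sum_(i < N) w i * f i * f i = \sum_(i < N) w i * f i ^+ 2.
    by apply: eq_bigr => i _; ring.
  by have := cM M; lra.
apply: (@le_trans _ _ (alpha * chi 0)); first by rewrite ler_wpM2l// ltW.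
have [chi00|chi_pos] := leP (chi 0) 0.
  apply: (@le_trans _ _ 0); first by rewrite mulr_ge0_le0// ltW.
  rewrite /Dform addr_ge0//.
    apply: mulr_ge0; last exact: sqr_ge0.
    by rewrite mulr_ge0 ?(a0_ge0 H)// ltW// (w_gt0 H).
  apply: sumr_ge0 => i _; apply: mulr_ge0; last exact: sqr_ge0.
  by rewrite mulr_ge0// ltW ?(w_gt0 H)// (b_gt0 H).
have [C HC] := phi_decay dec phiL.
pose v t := chi t / chi 0.
have v0 t : 0 <= t -> 0 <= v t by move=> t0; rewrite divr_ge0 ?chi0// ltW.
have v2 t : 0 <= t -> v t ^+ 2 <= v (t + t).
  (* With y = chi 0, this x minimises the quadratic form, which then yields its discriminant. *)
  move=> t0; have := chi_log_convex (- chi t) (chi 0) phiL t0.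
  rewrite -/(chi 0) -/(chi t) -/(chi (t + t)) => Z.
  rewrite /v expr_div_n ler_pdivrMr ?exprn_gt0// expr2 mulrA mulfVK ?gt_eqF//.
  rewrite -(ler_pM2r chi_pos).
  by move: Z; set X := chi t; set Y := chi (t + t); set U := chi 0; nra.
have vn s n : 0 <= s -> v s ^+ (2 ^ n) <= v (2 ^+ n * s).
  move=> s0; elim: n => [|n IH]; first by rewrite expn0 expr1 expr0 mul1r.
  have ns0 : 0 <= 2 ^+ n * s by rewrite mulr_ge0 ?exprn_ge0.
  rewrite expnSr exprM; apply: le_trans (_ : v (2 ^+ n * s) ^+ 2 <= _).
    by rewrite lerXn2r ?nnegrE ?exprn_ge0 ?v0.
  have -> : 2 ^+ n.+1 * s = 2 ^+ n * s + 2 ^+ n * s by rewrite exprS; ring.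
  exact: v2.
have chi_exp s : 0 < s -> chi s <= chi 0 * expR (- (alpha * s)).
  move=> s0; suff : v s * expR (alpha * s) <= 1.
    by rewrite expRN -ler_pdivlMr ?expR_gt0// mul1r /v ler_pdivrMr// mulrC.
  apply: (@power_bounded_le1 _ (C / chi 0)).
  have [A [_ HA]] := HC.
  have [n0 n0A] : exists n0 : nat, forall n, (n0 <= n)%N -> A < 2 ^+ n * s.
    exists (Num.bound `|A / s|) => n n0n; rewrite -ltr_pdivrMr//.
    apply: le_lt_trans (ler_norm _) _.
    apply: lt_le_trans (archi_boundP (normr_ge0 _)) _; rewrite -natrX ler_nat.
    by apply: leq_trans n0n _; apply: ltnW; rewrite ltn_expl.
  exists n0 => // n /= n0n.
  rewrite exprMn -expRM_natl natrX mulrCA.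
  have ns0 : 0 <= 2 ^+ n * s by rewrite mulr_ge0 ?exprn_ge0// (ltW s0).
  have := HA _ (n0A n n0n); rewrite /= -/(chi _) (ger0_norm (chi0 _ ns0)).
  rewrite mulNr expRN ler_pdivlMr ?expR_gt0// => K.
  apply: le_trans (_ : v (2 ^+ n * s) * expR (alpha * (2 ^+ n * s)) <= _).
    by rewrite ler_wpM2r ?expR_ge0// vn// (ltW s0).
  by rewrite /v mulrAC ler_pM2r ?invr_gt0.
(* The bound e^{-x} <= 1 / (1 + x) makes the estimate polynomial in s, so that s -> 0 is
   immediate. *)
have key s : 0 < s -> alpha * chi 0 <= Dform w a b f N * (1 + alpha * s).
  move=> s0; have as0 : 0 < alpha * s by rewrite mulr_gt0.
  have D1 := phi_drop_le H f0 s0.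
  have D2 := chi_exp s s0.
  have D3 : expR (- (alpha * s)) <= (1 + alpha * s)^-1.
    by rewrite expRN lef_pV2 ?posrE ?expR_gt0 ?addr_gt0// expR_ge1Dx.
  have D4 : chi 0 * expR (- (alpha * s)) <= chi 0 / (1 + alpha * s).
    by rewrite ler_wpM2l// ltW.
  have D5 : chi 0 - chi 0 / (1 + alpha * s) <= s * Dform w a b f N.
    by move: D1 D2 D4; rewrite /chi; lra.
  have as1 : 0 < 1 + alpha * s by rewrite addr_gt0.
  rewrite -(ler_pM2l s0).
  have -> : s * (alpha * chi 0) = (chi 0 - chi 0 / (1 + alpha * s)) * (1 + alpha * s).
    by field; rewrite gt_eqF.
  by rewrite mulrA ler_pM2r.
set D := Dform _ _ _ _ _ in key *.
have lim : D * (1 + alpha * s) @[s --> 0^'+] --> D * (1 + alpha * 0).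
  apply: cvg_at_right_filter; apply: cvgM; first exact: cvg_cst.
  apply: cvgD; first exact: cvg_cst.
  by apply: cvgM; [exact: cvg_cst | exact: cvg_id].
have -> : D = D * (1 + alpha * 0) by ring.
apply: (cvgr_to_ge lim); near=> s; apply: key.
by near: s; exact: nbhs_right_gt.
Unshelve. all: by end_near. Qed.

End Decay.

(** * Test functions *)

Section TestFunctions.
Context {R : realType}.

(** Ohm's law: a unit potential drop, linear in the resistance, dissipates the inverse of the total
    resistance. *)
Lemma tail_energy (c : nat -> R) m N : (m < N)%N -> (forall i, 0 < c i) ->
  let rho i := \sum_(i <= j < N) (c j)^-1 in
  \sum_(m <= i < N) c i * (rho i / rho m - rho i.+1 / rho m) ^+ 2 = (rho m)^-1.
Proof.
move=> mN c0 rho.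
have rm0 : 0 < rho m.
  rewrite /rho big_ltn// ltr_pwDl ?invr_gt0// sumr_ge0// => i _.
  by rewrite invr_ge0 ltW.
transitivity (\sum_(m <= i < N) (c i)^-1 * (rho m ^+ 2)^-1).
  apply: eq_big_nat => i /andP[mi iN].
  rewrite {1}/rho big_ltn// -/(rho i.+1).
  by field; rewrite !gt_eqF.
by rewrite -mulr_suml -/(rho m); field; rewrite gt_eqF.
Qed.

(** The best c is p / (p + r). This eliminates the unknown constant of [decay_energy]. *)
Lemma variance_two_blocks (p r c : R) : 0 < p -> 0 < r ->
  (p^-1 + r^-1)^-1 <= p * (1 - c) ^+ 2 + r * (0 - c) ^+ 2.
Proof.
move=> p0 r0; rewrite -subr_ge0.
have pr0 : 0 < p + r by rewrite addr_gt0.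
have -> : p * (1 - c) ^+ 2 + r * (0 - c) ^+ 2 - (p^-1 + r^-1)^-1 =
    (p * (1 - c) - r * c) ^+ 2 / (p + r).
  by field; rewrite !gt_eqF ?addr_gt0.
by rewrite divr_ge0 ?sqr_ge0// ltW.
Qed.

Context {w a b : nat -> R} {q : nat -> nat -> R -> R} {z : R -> R}.
Hypothesis H : bd_semigroup w a b q z.

(** Equilibrium potential between [0, n] and [m, oo): [maxn] freezes it at 1 on the left, an empty
    sum makes it 0 on the right. It is both a test function and, for large resistance, the tool for
    conservativeness. *)
Lemma cutoff n m : a 0%N = 0 -> (n < m)%N -> exists f : nat -> R,
  [/\ forall i, (i <= n)%N -> f i = 1, forall i, (m <= i)%N -> f i = 0 &
      Dform w a b f m = (\sum_(n <= j < m) (w j * b j)^-1)^-1].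
Proof.
move=> a00 nm.
have w0 := w_gt0 H; have b0 := b_gt0 H.
have c0 i : 0 < w i * b i by rewrite mulr_gt0.
pose rho i := \sum_(i <= j < m) (w j * b j)^-1.
have rn0 : 0 < rho n.
  rewrite /rho big_ltn// ltr_pwDl ?invr_gt0// sumr_ge0// => i _.
  by rewrite invr_ge0 ltW.
pose f i := rho (maxn i n) / rho n.
have f1 i : (i <= n)%N -> f i = 1.
  by move=> ni; rewrite /f (maxn_idPr ni) divff// gt_eqF.
exists f; split => // [i mi|].
  by rewrite /f /rho big_geq ?mul0r// leq_max mi.
rewrite /Dform a00 mulr0 mul0r add0r.
rewrite -(big_mkord xpredT (fun i => w i * b i * (f i - f i.+1) ^+ 2)).
rewrite (@big_cat_nat _ _ _ n) ?(ltnW nm)//= big_nat big1 ?add0r; last first.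
  by move=> i /andP[_ ni]; rewrite !f1 ?subrr ?expr0n ?mulr0// ltnW.
rewrite -(tail_energy nm c0); apply: eq_big_nat => i /andP[ni _].
by rewrite /f (maxn_idPl ni) (maxn_idPl (leq_trans ni (leqnSn _))).
Qed.

Lemma decay_reflecting alpha n m M : a 0%N = 0 -> 0 < alpha -> decays q alpha ->
  (n < m < M)%N ->
  alpha * \sum_(n <= j < m) (w j * b j)^-1 <=
    (\sum_(0 <= i < n.+1) w i)^-1 + (\sum_(m <= i < M) w i)^-1.
Proof.
move=> a00 alpha0 dec /andP[nm mM].
have w0 := w_gt0 H; have b0 := b_gt0 H.
have rn0 : 0 < \sum_(n <= j < m) (w j * b j)^-1.
  rewrite big_ltn// ltr_pwDl ?invr_gt0 ?mulr_gt0// sumr_ge0// => i _.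
  by rewrite invr_ge0 ltW// mulr_gt0.
have [f [f1 f0 fD]] := cutoff a00 nm.
have [c _ /(_ M (ltnW mM))] := decay_energy H alpha0 dec f0; rewrite fD.
set p := \sum_(0 <= i < n.+1) _; set r := \sum_(m <= i < M) _ => D.
have p0 : 0 < p.
  by rewrite /p big_ltn// ltr_pwDl// sumr_ge0// => i _; exact: ltW.
have r0 : 0 < r.
  by rewrite /r big_ltn// ltr_pwDl// sumr_ge0// => i _; exact: ltW.
have : p * (1 - c) ^+ 2 + r * (0 - c) ^+ 2 <= \sum_(i < M) w i * (f i - c) ^+ 2.
  rewrite -(big_mkord xpredT (fun i => w i * (f i - c) ^+ 2)).
  rewrite (@big_cat_nat _ _ _ m) ?(ltnW mM)//= (@big_cat_nat _ _ _ n.+1 0%N m)//=.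
  apply: lerD.
    rewrite -[leLHS]addr0; apply: lerD.
      rewrite /p mulr_suml le_eqVlt; apply/orP; left; apply/eqP.
      by apply: eq_big_nat => i /andP[_ ni]; rewrite f1.
    by apply: sumr_ge0 => i _; apply: mulr_ge0; [exact: ltW | exact: sqr_ge0].
  rewrite /r mulr_suml le_eqVlt; apply/orP; left; apply/eqP.
  by apply: eq_big_nat => i /andP[mi _]; rewrite f0.
move/(le_trans (variance_two_blocks c p0 r0))/(ler_wpM2l (ltW alpha0))/le_trans => /(_ _ D).
set u := p^-1 + r^-1.
have u0 : 0 < u by rewrite addr_gt0 ?invr_gt0.
by rewrite ler_pdivrMr// mulrC ler_pdivlMr.
Qed.

Lemma decay_absorbing alpha n m N : 0 < a 0%N -> 0 < alpha -> decays q alpha ->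
  (n <= m < N)%N ->
  alpha * \sum_(n <= j < m.+1) w j <=
    (\sum_(0 <= i < n.+1) (w i * a i)^-1)^-1 + (\sum_(m <= i < N) (w i * b i)^-1)^-1.
Proof.
move=> a00 alpha0 dec /andP[nm mN].
have w0 := w_gt0 H; have b0 := b_gt0 H.
have c0 i : 0 < w i * b i by rewrite mulr_gt0.
have s0 i : 0 < w i * a i by case: i => [|i]; rewrite mulr_gt0// (aS_gt0 H).
pose rho i := \sum_(i <= j < N) (w j * b j)^-1.
pose sigma i := \sum_(0 <= j < i.+1) (w j * a j)^-1.
have rm0 : 0 < rho m.
  rewrite /rho big_ltn// ltr_pwDl ?invr_gt0// sumr_ge0// => i _.
  by rewrite invr_ge0 ltW.
have sn0 : 0 < sigma n.
  rewrite /sigma big_ltn// ltr_pwDl ?invr_gt0// sumr_ge0// => i _.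
  by rewrite invr_ge0 ltW.
(* A trapezoid: linear in the resistance from the cemetery up to n, equal to 1 on [n, m], then
   linear down to 0 at N. Its slopes have energies 1 / sigma n and 1 / rho m. *)
pose f i := sigma (minn i n) / sigma n * (rho (maxn i m) / rho m).
have f0 i : (N <= i)%N -> f i = 0.
  by move=> Ni; rewrite /f /rho big_geq ?mul0r ?mulr0// leq_max Ni.
have fl i : (i <= m)%N -> f i = sigma (minn i n) / sigma n.
  by move=> im; rewrite /f (maxn_idPr im) divff ?mulr1// gt_eqF.
have fr i : (n <= i)%N -> f i = rho (maxn i m) / rho m.
  by move=> ni; rewrite /f (minn_idPr ni) divff ?mul1r// gt_eqF.
have f1 i : (n <= i)%N -> (i <= m)%N -> f i = 1.
  by move=> ni im; rewrite fr// (maxn_idPr im) divff// gt_eqF.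
have [c /(_ a00) -> /(_ N (leqnn _))] := decay_energy H alpha0 dec f0.
have -> : Dform w a b f N = (sigma n)^-1 + (rho m)^-1.
  rewrite /Dform -(big_mkord xpredT (fun i => w i * b i * (f i - f i.+1) ^+ 2)).
  rewrite (@big_cat_nat _ _ _ m) ?(ltnW mN)//= addrA; congr (_ + _); last first.
    rewrite -(tail_energy mN c0); apply: eq_big_nat => i /andP[mi _].
    rewrite !fr ?(leq_trans nm)//; last exact: leqW.
    by rewrite (maxn_idPl mi) (maxn_idPl (leq_trans mi (leqnSn _))).
  rewrite (@big_cat_nat _ _ _ n 0%N m)//= [X in _ + (_ + X)]big_nat.
  rewrite [X in _ + (_ + X)]big1 ?addr0; last first.
    by move=> i /andP[ni im]; rewrite !f1 ?subrr ?expr0n ?mulr0// ?(ltnW im)// leqW.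
  have -> : \sum_(0 <= i < n) w i * b i * (f i - f i.+1) ^+ 2 =
    \sum_(0 <= i < n) (w i.+1 * a i.+1)^-1 * (sigma n ^+ 2)^-1.
    apply: eq_big_nat => i /andP[_ ni].
    rewrite !fl ?(leq_trans ni nm) ?(leq_trans (ltnW ni) nm)//.
    rewrite (minn_idPl (ltnW ni)) (minn_idPl ni).
    have -> : sigma i.+1 = sigma i + (w i.+1 * a i.+1)^-1 by rewrite /sigma big_nat_recr.
    rewrite (w_balance H); field.
    by rewrite !gt_eqF.
  have -> : w 0%N * a 0%N * f 0%N ^+ 2 = (w 0%N * a 0%N)^-1 * (sigma n ^+ 2)^-1.
    rewrite fl// min0n {1}/sigma big_nat1; field.
    by rewrite !gt_eqF.
  rewrite -mulr_suml -mulrDl.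
  have -> : (w 0%N * a 0%N)^-1 + \sum_(0 <= i < n) (w i.+1 * a i.+1)^-1 = sigma n.
    by rewrite /sigma big_nat_recl.
  by field; rewrite gt_eqF.
move=> D; apply: le_trans D; rewrite ler_wpM2l ?(ltW alpha0)//.
rewrite -(big_mkord xpredT (fun i => w i * (f i - 0) ^+ 2)).
have t0 i : 0 <= w i * (f i - 0) ^+ 2.
  by apply: mulr_ge0; [exact: ltW | exact: sqr_ge0].
rewrite (@big_cat_nat _ _ _ n 0%N N) ?(leq_trans nm (ltnW mN))//= -[leLHS]add0r.
apply: lerD; first exact: sumr_ge0.
rewrite (@big_cat_nat _ _ _ m.+1 n N) ?(leq_trans nm)// -[leLHS]addr0.
apply: lerD; last exact: sumr_ge0.
rewrite le_eqVlt; apply/orP; left; apply/eqP.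
by apply: eq_big_nat => i /andP[ni im]; rewrite f1// subr0 expr1n mulr1.
Qed.

End TestFunctions.

(** * Two-sided Hardy inequality *)

Section Bilateral.
Context {R : realType}.

(** The left conditions bound x above by M_n + K / Rs_n, the right ones bound it below by M_{m+1} -
    K tau_{m+1}. Every upper bound dominates every lower one, by hypothesis if n <= m and by
    monotonicity of M if n > m; so the infimum of the upper bounds works. *)
Lemma split_point (w Rs tau : nat -> R) (K : R) :
  (forall k, 0 <= w k) -> (forall k, 0 < Rs k) -> (forall k, 0 <= tau k) -> 0 <= K ->
  (forall n m, (n <= m)%N ->
     \sum_(n <= j < m.+1) w j <= K * ((Rs n)^-1 + tau m.+1)) ->
  exists2 x : R, 0 <= x &
    (forall n, (x - \sum_(i < n) w i) * Rs n <= K) /\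
    (forall m, \sum_(i < m.+1) w i - x <= K * tau m.+1).
Proof.
move=> w0 Rs0 tau0 K0 HK; pose M k := \sum_(i < k) w i.
pose A n := M n + K * (Rs n)^-1.
have A0 n : 0 <= A n.
  by rewrite addr_ge0 ?sumr_ge0// mulr_ge0// invr_ge0 ltW.
have Ai : has_inf (range A) by split; [exists (A 0%N), 0%N | exists 0 => _ [n _ <-]].
exists (inf (range A)); first by apply: lb_le_inf => [|_ [n _ <-]//]; exists (A 0%N), 0%N.
split=> [n|m].
  rewrite -ler_pdivlMr// lerBlDl.
  by apply: inf_lbound; [exact: Ai.2 | exists n].
rewrite lerBlDl -lerBlDr; apply: lb_le_inf => [|_ [n _ <-]]; first by exists (A 0%N), 0%N.
rewrite /A; have [nm|mn] := leqP n m.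
  have := HK n m nm; rewrite mulrDr.
  have -> : \sum_(i < m.+1) w i = M n + \sum_(n <= j < m.+1) w j.
    by rewrite /M -!(big_mkord xpredT w) -big_cat_nat//= leqW.
  by lra.
have : \sum_(i < m.+1) w i <= M n by exact: ler_sum_ord.
have : 0 <= K * (Rs n)^-1 by rewrite mulr_ge0// invr_ge0 ltW.
have : 0 <= K * tau m.+1 by rewrite mulr_ge0.
by lra.
Qed.

Lemma bilateral_hardy_divergent (w r Rs h e : nat -> R) (K : R) :
  (forall k, 0 <= w k) -> (forall k, 0 < r k.+1) -> (forall k, 0 < Rs k) ->
  (forall k, Rs k.+1 = Rs k + r k.+1) -> 0 <= K ->
  (forall n m, (n <= m)%N -> \sum_(n <= j < m.+1) w j <= K * (Rs n)^-1) ->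
  (forall k, e k.+1 = (h k.+1 - h k) ^+ 2 / r k.+1) ->
  h 0%N ^+ 2 / Rs 0%N <= e 0%N ->
  forall N, \sum_(i < N.+1) w i * h i ^+ 2 <= 4 * K * \sum_(i < N.+1) e i.
Proof.
move=> w0 r0 Rs0 RsS K0 HK eS base N.
(* With tau = 0 the right conditions put x above every partial sum, so nothing lies to the right of
   the cut. *)
have [|x x0 [xR xM]] := @split_point w Rs (fun=> 0) K w0 Rs0 (fun=> lexx 0) K0.
  by move=> n m nm; rewrite addr0 HK.
apply: (@hardy_left _ w r Rs h e K x) => // -[|k]; first by rewrite big_ord0 subr0.
by have := xM k; rewrite mulr0; lra.
Qed.

Lemma bilateral_hardy_convergent (w r Rs T h e : nat -> R) (K E : R) :
  (forall k, 0 <= w k) -> (forall k, 0 < r k.+1) -> (forall k, 0 < Rs k) ->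
  (forall k, Rs k.+1 = Rs k + r k.+1) -> 0 <= K ->
  (forall k, 0 < T k) -> (forall k, T k.+1 = T k.+2 + r k.+1) ->
  (forall n m, (n <= m)%N ->
     \sum_(n <= j < m.+1) w j <= K * ((Rs n)^-1 + (T m.+1)^-1)) ->
  (forall k, e k.+1 = (h k.+1 - h k) ^+ 2 / r k.+1) ->
  h 0%N ^+ 2 / Rs 0%N <= e 0%N ->
  h n @[n --> \oo] --> 0 -> (forall N, \sum_(i < N) e i <= E) ->
  forall N, \sum_(i < N.+1) w i * h i ^+ 2 <= 4 * K * E.
Proof.
move=> w0 r0 Rs0 RsS K0 T0 TS HK eS base hc HE N.
have T'0 k : 0 <= (T k)^-1 by rewrite invr_ge0 ltW.
have [x x0 [xR xM]] := @split_point w Rs (fun k => (T k)^-1) K w0 Rs0 T'0 K0 HK.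
apply: (@hardy_right _ w r Rs T h e K x) => //.
- by move=> k; rewrite -ler_pdivlMr// xM.
- by apply: le_trans base; rewrite divr_ge0 ?sqr_ge0// ltW.
- by right.
Qed.

(* Finite energy gives a limit, since the resistances are summable, and the
   infinite mass of w forces it to be 0. *)
Lemma finite_energy_cvg0 (w r T h e : nat -> R) (E C : R) :
  (forall k, 0 <= w k) -> (forall k, 0 < r k.+1) ->
  (forall k, 0 < T k) -> (forall k, T k.+1 = T k.+2 + r k.+1) ->
  T k @[k --> \oo] --> 0 ->
  (forall k, e k.+1 = (h k.+1 - h k) ^+ 2 / r k.+1) -> 0 <= e 0%N ->
  (forall N, \sum_(i < N) e i <= E) ->
  (forall N, \sum_(i < N) w i * h i ^+ 2 <= C) ->
  (forall A, exists n, A < \sum_(i < n) w i) ->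
  h n @[n --> \oo] --> 0.
Proof.
move=> w0 r0 T0 TS Tc eS e0 HE HC winf.
have E0 : 0 <= E by have := HE 0%N; rewrite big_ord0.
have ek0 k : 0 <= e k by case: k => // k; rewrite eS divr_ge0 ?sqr_ge0// ltW.
have inc N m : (h (N + m)%N - h N) ^+ 2 <= T N.+1 * E.
  apply: le_trans (increment_bound r0 eS N m) _.
  have TT : T N.+1 = \sum_(i < m) r (N + i).+1 + T (N + m).+1.
    elim: m => [|m IH]; first by rewrite big_ord0 addn0 add0r.
    by rewrite IH big_ord_recr /= TS addnS; ring.
  apply: ler_pM.
  - by apply: sumr_ge0 => i _; exact: ltW.
  - by apply: sumr_ge0.
  - by rewrite TT lerDl ltW.
  apply: le_trans (HE (N.+1 + m)%N).
  by rewrite big_split_ord /= lerDr sumr_ge0.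
have Tdec N m : T (N + m).+1 <= T N.+1.
  elim: m => [|m IH]; first by rewrite addn0.
  by apply: le_trans IH; rewrite [leRHS]TS addnS lerDl ltW.
apply/cvgrPdist_le => eps eps0.
have e20 : 0 < eps / 2 by rewrite divr_gt0.
have [N TN] : exists N, T N.+1 * E <= (eps / 2) ^+ 2.
  have Tl : T k * E @[k --> \oo] --> 0 * E by apply: cvgM; [exact: Tc | exact: cvg_cst].
  have /cvgrPdist_le/(_ _ (exprn_gt0 2 e20)) [N _ HN] := Tl.
  exists N; have := HN N.+1 (leqnSn _); rewrite /= mul0r sub0r normrN.
  by apply: le_trans; exact: ler_norm.
have [m0 Nm0 hm0] : exists2 m0, (N <= m0)%N & `|h m0| <= eps / 2.
  (* If |h| stayed above eps / 2 from N on, the mass between N and this n would push sum w h^2 above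
     C. *)
  have [n Hn] := winf (\sum_(i < N) w i + C / (eps / 2) ^+ 2).
  apply/not_exists2P => hbig.
  have : \sum_(i < n) w i * (eps / 2) ^+ 2 <=
      \sum_(i < N) w i * (eps / 2) ^+ 2 + \sum_(i < n) w i * h i ^+ 2.
    have -> : \sum_(i < N) w i * (eps / 2) ^+ 2 =
       \sum_(i < N) (if (i < N)%N then w i * (eps / 2) ^+ 2 else 0).
      by apply: eq_bigr => i _; rewrite ltn_ord.
    have : \sum_(i < n) w i * (eps / 2) ^+ 2 <= \sum_(i < n)
        ((if (i < N)%N then w i * (eps / 2) ^+ 2 else 0) + w i * h i ^+ 2).
      apply: ler_sum => i _; case: ltnP => [_|Ni].
        by rewrite lerDl; apply: mulr_ge0 => //; exact: sqr_ge0.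
      rewrite add0r; apply: ler_wpM2l => //.
      have [//|] := hbig i; move/negP; rewrite -ltNge => hi.
      by rewrite -[leRHS]real_normK ?num_real// lerXn2r ?nnegrE// ltW.
    rewrite big_split /= => /le_trans; apply; rewrite lerD2r.
    pose u i := if (i < N)%N then w i * (eps / 2) ^+ 2 else 0.
    have u0 i : 0 <= u i.
      by rewrite /u; case: ifP => // _; apply: mulr_ge0 => //; exact: sqr_ge0.
    rewrite -/(u _); have [nN|Nn] := leqP n N; first exact: (@ler_sum_ord _ u u).
    rewrite -(subnKC (ltnW Nn)) big_split_ord /= [X in _ + X]big1 ?addr0// => i _.
    by rewrite /u ltnNge leq_addr.
  rewrite -!mulr_suml; have := HC n.
  have p0 : 0 < (eps / 2) ^+ 2 by rewrite exprn_gt0.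
  have : C < (\sum_(i < n) w i - \sum_(i < N) w i) * (eps / 2) ^+ 2.
    by rewrite -ltr_pdivrMr//; move: Hn; lra.
  by lra.
near=> n; rewrite sub0r normrN.
have m0n : (m0 <= n)%N by near: n; exact: nbhs_infty_ge.
have : `|h n - h m0| <= eps / 2.
  rewrite -(@ler_pXn2r _ 2) ?nnegrE//; last exact: ltW.
  rewrite real_normK ?num_real//; apply: le_trans TN.
  rewrite -(subnKC m0n); apply: le_trans (inc _ _) _.
  by rewrite ler_wpM2r// -(subnKC Nm0) Tdec.
move=> hn; rewrite -(subrKC (h m0) (h n)).
by apply: le_trans (ler_normD _ _) _; lra.
Unshelve. all: by end_near. Qed.

(* Continuous induction along [0, T]; F is not assumed continuous, its
   monotonicity is enough. *)
Lemma exp_decay_of_drop (F : R -> R) (lam : R) : 0 <= lam ->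
  (forall t, 0 <= t -> 0 <= F t) ->
  (forall s t, 0 <= s -> 0 <= t -> F (t + s) <= F t) ->
  (forall t, 0 <= t -> \forall h \near 0^'+, F (t + h) <= F t - lam * h * F t) ->
  forall t, 0 <= t -> F t <= F 0 * expR (- lam * t).
Proof.
move=> lam0 F0 Fdec Fdrop T T0.
pose S := [set t | 0 <= t <= T /\ F t <= F 0 * expR (- lam * t)].
have S0 : S 0 by split; [rewrite lexx T0 | rewrite mulr0 expR0 mulr1].
have Ssup : has_sup S by split; [exists 0 | exists T => t [/andP[]]].
set s := sup S.
have s0 : 0 <= s by apply: (ub_le_sup Ssup.2).
have sT : s <= T by apply: (ge_sup Ssup.1) => t [/andP[]].
(* S contains its supremum: F s <= F t for t in S just below s, and the factor e^{lam e} lost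
   between t and s tends to 1. *)
have Ss : F s <= F 0 * expR (- lam * s).
  rewrite mulNr expRN ler_pdivlMr ?expR_gt0//.
  have lim : F 0 * expR (lam * e) @[e --> 0^'+] --> F 0 * expR (lam * 0).
    apply: cvg_at_right_filter; apply: cvgM; first exact: cvg_cst.
    apply: (@continuous_cvg _ _ _ _ _ (fun e => lam * e) expR); first exact: continuous_expR.
    by apply: cvgM; [exact: cvg_cst | exact: cvg_id].
  have -> : F 0 = F 0 * expR (lam * 0) by rewrite mulr0 expR0 mulr1.
  apply: (cvgr_to_ge lim); near=> e.
  have e0 : 0 < e by near: e; exact: nbhs_right_gt.
  have [t [/andP[t0 tT] Ft] te] := sup_adherent e0 Ssup.
  have ts : t <= s by apply: (ub_le_sup Ssup.2); split; rewrite ?t0.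
  have Fst : F s <= F t.
    by have := Fdec (s - t) t; rewrite subrKC subr_ge0; apply.
  have : F s * expR (lam * t) <= F 0.
    rewrite -ler_pdivlMr ?expR_gt0// -expRN -mulNr; exact: le_trans Fst Ft.
  have -> : lam * s = lam * t + lam * (s - t) by ring.
  rewrite expRD mulrA => Ft0.
  apply: ler_pM => //; rewrite ?expR_ge0//.
    by rewrite mulr_ge0 ?F0 ?expR_ge0.
  by rewrite ler_expR ler_wpM2l//; move: te; rewrite -/s; lra.
have [sT'|Ts] := ltP s T; last first.
  by have -> : T = s by apply/eqP; rewrite eq_le Ts sT.
have : exists2 h, 0 < h & S (s + h).
  near (0 : R)^'+ => h; exists h; first by near: h; exact: nbhs_right_gt.
  have h0 : 0 < h by near: h; exact: nbhs_right_gt.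
  have hT : h < T - s by near: h; apply: nbhs_right_lt; rewrite subr_gt0.
  have Fh : F (s + h) <= F s - lam * h * F s by near: h; exact: Fdrop.
  split; first by rewrite addr_ge0 ?(ltW h0)//=; lra.
  apply: le_trans Fh _.
  have -> : F s - lam * h * F s = F s * (1 + - lam * h) by ring.
  apply: le_trans (ler_wpM2l (F0 s s0) (expR_ge1Dx _)) _.
  by rewrite mulrDr expRD mulrA ler_wpM2r// expR_ge0.
move=> [h h0 Sh].
by have := ub_le_sup Ssup.2 Sh; rewrite -/s; lra.
Unshelve. all: by end_near. Qed.

End Bilateral.

(** * From Hardy inequalities to exponential decay *)

Section LowerBound.
Context {R : realType}.
Context {w a b : nat -> R} {q : nat -> nat -> R -> R} {z : R -> R}.
Hypothesis H : bd_semigroup w a b q z.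

Lemma q_up_rate i : q i i.+1 h / h @[h --> 0^'+] --> b i.
Proof.
have := q_rate H i i.+1; rewrite /bd_rate eqxx (q_id H).
have -> : (i == i.+1) = false by apply/negbTE; rewrite neq_ltn ltnSn.
by under eq_fun do rewrite subr0.
Qed.

Lemma Dform_ge0 g n : 0 <= Dform w a b g n.
Proof.
apply: addr_ge0.
  apply: mulr_ge0; last exact: sqr_ge0.
  by rewrite mulr_ge0 ?(a0_ge0 H)// ltW// (w_gt0 H).
apply: sumr_ge0 => i _; apply: mulr_ge0; last exact: sqr_ge0.
by rewrite mulr_ge0// ltW ?(w_gt0 H) ?(b_gt0 H).
Qed.

(** The energy at time t is that of P_{t/2} f, since phi(t) = |P_{t/2} f|^2. Hence phi decays at the
    rate of the Poincare inequality itself, without a factor 2. *)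
Lemma phi_exp_decay f N (K L lam : R) : 0 < K -> 0 <= lam -> lam * K < 1 ->
  (forall t, 0 <= t -> L <= phi w q f N t) ->
  (forall t E, 0 <= t -> (forall n, Dform w a b (Pt q f N t) n <= E) ->
     phi w q f N (t + t) - L <= K * E) ->
  forall t, 0 <= t ->
    phi w q f N t - L <= (phi w q f N 0 - L) * expR (- lam * t).
Proof.
move=> K0 lam0 lamK phiL poincare.
apply: (@exp_decay_of_drop _ (fun t => phi w q f N t - L)) => //.
- by move=> t t0; rewrite subr_ge0 phiL.
- by move=> s t s0 t0; rewrite lerD2r; exact: (phi_nonincreasing H).
move=> t t0; set F := phi w q f N t - L.
have t20 : 0 <= t / 2 by rewrite divr_ge0.
have [F0|F0] := leP F 0.
  have -> : F = 0 by apply/eqP; rewrite eq_le F0 /F subr_ge0 phiL.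
  near=> h; rewrite mulr0 subr0.
  have h0 : 0 < h by near: h; exact: nbhs_right_gt.
  by apply: le_trans F0; rewrite lerD2r; apply: (phi_nonincreasing H) => //; exact: ltW.
(* Otherwise the Poincare inequality would give F <= K lam F < F. Fixing n leaves only finitely many
   small-time limits to control. *)
have [n Dn] : exists n, lam * F < Dform w a b (Pt q f N (t / 2)) n.
  apply/not_existsP => Dle.
  have := poincare (t / 2) (lam * F) t20; rewrite -splitr -/F.
  have {}Dle n : Dform w a b (Pt q f N (t / 2)) n <= lam * F.
    by rewrite leNgt; apply/negP; exact: Dle.
  move=> /(_ Dle); rewrite mulrA [K * lam]mulrC leNgt => /negP; apply.
  by rewrite -[ltRHS]mul1r ltr_pM2r.
set g := Pt q f N (t / 2) in Dn.
have lim : \sum_(i < n) w i * (q i i.+1 h / h) * (g i - g i.+1) ^+ 2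
    + w 0%N * (z h / h) * g 0%N ^+ 2 @[h --> 0^'+] --> Dform w a b g n.
  rewrite /Dform addrC; apply: cvgD.
    apply: (@cvg_sum_ord _ _ _ _ _ (fun i h => w i * (q i i.+1 h / h) * (g i - g i.+1) ^+ 2)
      (fun i => w i * b i * (g i - g i.+1) ^+ 2)) => i _.
    apply: cvgM; last exact: cvg_cst.
    by apply: cvgM; [exact: cvg_cst | exact: q_up_rate].
  apply: cvgM; last exact: cvg_cst.
  by apply: cvgM; [exact: cvg_cst | exact: (z_rate H)].
near=> h.
have h0 : 0 < h by near: h; exact: nbhs_right_gt.
have : lam * F < \sum_(i < n) w i * (q i i.+1 h / h) * (g i - g i.+1) ^+ 2
    + w 0%N * (z h / h) * g 0%N ^+ 2.
  by near: h; apply: (cvgr_gt _ lim).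
have := phi_edges H f N n (ltW h0) t20; rewrite -splitr -/g.
have -> : \sum_(i < n) w i * (q i i.+1 h / h) * (g i - g i.+1) ^+ 2
    + w 0%N * (z h / h) * g 0%N ^+ 2 =
   (\sum_(i < n) w i * q i i.+1 h * (g i - g i.+1) ^+ 2 + w 0%N * z h * g 0%N ^+ 2) / h.
  rewrite mulrDl mulr_suml; congr (_ + _); last by ring.
  by apply: eq_bigr => i _; ring.
by rewrite ltr_pdivlMr// /F; lra.
Unshelve. all: by end_near. Qed.

(** L is only a lower bound: the true limit l satisfies L <= l <= phi(t), so phi - l inherits the
    estimate. *)
Lemma decays_of_phi (lam : R) :
  (forall f N, exists L C : R, (forall t, 0 <= t -> L <= phi w q f N t) /\
    forall t, 0 <= t -> phi w q f N t - L <= C * expR (- lam * t)) ->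
  decays q lam.
Proof.
move=> dec i j.
have {}dec f N : exists2 l : R, phi w q f N t @[t --> +oo] --> l &
    exp_bounded lam (fun t => phi w q f N t - l).
  have [L [C [phiL phiC]]] := dec f N.
  have [l phil] := phi_is_cvg H f N; exists l => //.
  have Ll : L <= l.
    apply: (cvgr_to_ge phil); near=> t; apply: phiL.
    by near: t; apply: nbhs_pinfty_ge; rewrite num_real.
  exists C; near=> t.
  have t0 : 0 <= t by near: t; apply: nbhs_pinfty_ge; rewrite num_real.
  have lt : l <= phi w q f N t.
    apply: (cvgr_to_le phil); near=> u.
    have tu : t <= u by near: u; apply: nbhs_pinfty_ge; rewrite num_real.
    by rewrite -(subrKC t u); apply: (phi_nonincreasing H); rewrite ?subr_ge0.
  rewrite ger0_norm ?subr_ge0//; apply: le_trans (phiC t t0).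
  by rewrite lerD2l lerN2.
pose N := (maxn i j).+1.
have iN : (i < N)%N by rewrite ltnS leq_maxl.
have jN : (j < N)%N by rewrite ltnS leq_maxr.
have [l1 h1 d1] := dec (delta2 1 1 i j) N.
have [l2 h2 d2] := dec (delta2 1 0 i j) N.
have [l3 h3 d3] := dec (delta2 0 1 i j) N.
have E t : 0 <= t -> q i j t = (phi w q (delta2 1 1 i j) N t - phi w q (delta2 1 0 i j) N t
    - phi w q (delta2 0 1 i j) N t) / (2 * w i) by move=> t0; exact: (q_polar H).
have LE : limit_prob q i j = (l1 - l2 - l3) / (2 * w i).
  have lij := @limit_prob_cvg _ _ _ _ _ _ H i j; apply: (cvg_unique _ lij) => //.
  have FE : \forall t \near +oo, (phi w q (delta2 1 1 i j) N t
      - phi w q (delta2 1 0 i j) N t - phi w q (delta2 0 1 i j) N t) / (2 * w i) = q i j t.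
    near=> t; have t0 : 0 <= t by near: t; apply: nbhs_pinfty_ge; rewrite num_real.
    by rewrite -E.
  apply: cvg_trans; first exact: (near_eq_cvg FE).
  apply: cvgM; last exact: cvg_cst.
  by apply: cvgB => //; apply: cvgB.
have D := exp_boundedZ (2 * w i)^-1 (exp_boundedD d1
  (exp_boundedD (exp_boundedZ (-1) d2) (exp_boundedZ (-1) d3))).
apply: (exp_bounded_le D); near=> t.
have t0 : 0 <= t by near: t; apply: nbhs_pinfty_ge; rewrite num_real.
rewrite LE E// le_eqVlt; apply/orP; left; apply/eqP; congr (`|_|).
by have w0 := w_gt0 H i; field; rewrite gt_eqF.
Unshelve. all: by end_near. Qed.

Lemma decays_of_poincare (K lam : R) : 0 < K -> 0 <= lam -> lam * K < 1 ->
  (forall f N, exists L : R, (forall t, 0 <= t -> L <= phi w q f N t) /\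
    forall t E, 0 <= t -> (forall n, Dform w a b (Pt q f N t) n <= E) ->
     phi w q f N (t + t) - L <= K * E) ->
  decays q lam.
Proof.
move=> K0 lam0 lamK poincare; apply: decays_of_phi => f N.
have [L [phiL pL]] := poincare f N.
exists L, (phi w q f N 0 - L); split => // t t0.
exact: (phi_exp_decay K0 lam0 lamK phiL pL).
Qed.

(** C expresses that g is square-integrable; when the resistances are summable, this is what makes g
    vanish at infinity. *)
Lemma decays_of_hardy (K lam : R) : 0 < K -> 0 <= lam -> lam * (4 * K) < 1 ->
  (forall (g : nat -> R) (E C : R), (forall n, Dform w a b g n <= E) ->
    (forall n, \sum_(i < n) w i * g i ^+ 2 <= C) ->
    forall n, \sum_(i < n.+1) w i * g i ^+ 2 <= 4 * K * E) ->
  decays q lam.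
Proof.
move=> K0 lam0 lamK hardy.
apply: (@decays_of_poincare (4 * K)) => //; first by rewrite mulr_gt0.
move=> f N; exists 0; split=> [t|t E t0 DE]; first exact: (phi_ge0 H).
rewrite subr0; have lim := @PtM_cvg _ _ _ _ _ _ H f N _ _ t0 t0.
apply: (cvgr_to_le lim); near=> n.
have n0 : (0 < n)%N by near: n; exact: nbhs_infty_gt.
have := hardy _ _ _ DE (fun m => @Pt_sqr_le _ _ _ _ _ _ H f N _ m t0) n.-1; rewrite prednK//.
by apply: le_trans; rewrite le_eqVlt; apply/orP; left; apply/eqP;
  apply: eq_bigr => i _; ring.
Unshelve. all: by end_near. Qed.

(** Edge k joins k - 1 to k, and edge 0 joins 0 to the cemetery: the indexing of [hardy_core]. *)
Definition edge_energy (w a b g : nat -> R) k :=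
  if k is k'.+1 then w k' * b k' * (g k - g k') ^+ 2 else w 0%N * a 0%N * g 0%N ^+ 2.

Lemma sum_edge_energy g n : \sum_(i < n.+1) edge_energy w a b g i = Dform w a b g n.
Proof.
rewrite big_ord_recl /= /Dform; congr (_ + _).
by apply: eq_bigr => i _; rewrite /= -sqrrN opprB.
Qed.

Lemma sum_edge_energy_le g E : (forall n, Dform w a b g n <= E) ->
  forall n, \sum_(i < n) edge_energy w a b g i <= E.
Proof.
move=> DE [|n]; last by rewrite sum_edge_energy.
by rewrite big_ord0; apply: le_trans (DE 0%N); exact: Dform_ge0.
Qed.

(** [r0] belongs to edge 0: it is 1 / (w_0 a_0) under killing, and an arbitrary positive number
    under reflection. *)
Definition resistance (w b : nat -> R) (r0 : R) k :=
  if k is k'.+1 then (w k' * b k')^-1 else r0.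

Lemma edge_energyS g r0 k :
  edge_energy w a b g k.+1 = (g k.+1 - g k) ^+ 2 / resistance w b r0 k.+1.
Proof. by rewrite /= invrK mulrC. Qed.

Lemma killed_resistance n : 
  \sum_(0 <= i < n.+1) (w i * a i)^-1 =
  \sum_(i < n.+1) resistance w b (w 0%N * a 0%N)^-1 i.
Proof.
rewrite big_mkord; apply: eq_bigr => -[[|i] iN] _ //=.
by rewrite (w_balance H).
Qed.

(** With [rho k] the resistance from k to infinity, entry k is the total resistance of the edges k,
    k + 1, and so on. *)
Definition tail (w b rho : nat -> R) (r0 : R) k :=
  if k is k'.+1 then rho k' else rho 0%N + r0.

Lemma decays_killed_recurrent (K lam : R) : 0 < a 0%N -> 0 < K ->
  (forall n m, (n <= m)%N -> \sum_(n <= j < m.+1) w j <=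
     K * (\sum_(0 <= i < n.+1) (w i * a i)^-1)^-1) ->
  0 <= lam -> lam * (4 * K) < 1 -> decays q lam.
Proof.
move=> a00 K0 HK lam0 lamK; apply: (decays_of_hardy K0 lam0 lamK) => g E C DE _ n.
have w0 := w_gt0 H; have b0 := b_gt0 H.
set r := resistance w b (w 0%N * a 0%N)^-1.
have r0 k : 0 < r k by case: k => [|k]; rewrite /r /= invr_gt0 mulr_gt0.
apply: (@le_trans _ _ (4 * K * \sum_(i < n.+1) edge_energy w a b g i)); last first.
  by rewrite ler_wpM2l ?mulr_ge0 ?(ltW K0)// sum_edge_energy.
apply: (@bilateral_hardy_divergent _ w r (fun k => \sum_(i < k.+1) r i)) => //.
- by move=> k; exact: ltW.
- by move=> k; rewrite big_ord_recl ltr_pwDl// sumr_ge0// => i _; exact: ltW.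
- by move=> k; rewrite big_ord_recr.
- exact: ltW.
- by move=> i j ij; rewrite -killed_resistance; exact: HK.
- by move=> k; exact: edge_energyS.
- by rewrite big_ord1 /r /= invrK mulrC.
Qed.

Lemma decays_killed_transient (rho : nat -> R) (K lam : R) : 0 < a 0%N -> 0 < K ->
  (forall k, 0 < rho k) -> (forall k, rho k = rho k.+1 + (w k * b k)^-1) ->
  rho k @[k --> \oo] --> 0 -> (forall A, exists n, A < \sum_(i < n) w i) ->
  (forall n m, (n <= m)%N -> \sum_(n <= j < m.+1) w j <=
     K * ((\sum_(0 <= i < n.+1) (w i * a i)^-1)^-1 + (rho m)^-1)) ->
  0 <= lam -> lam * (4 * K) < 1 -> decays q lam.
Proof.
move=> a00 K0 rho0 rhoS rhoc winf HK lam0 lamK.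
apply: (decays_of_hardy K0 lam0 lamK) => g E C DE gC n.
have w0 := w_gt0 H; have b0 := b_gt0 H.
set r := resistance w b (w 0%N * a 0%N)^-1.
have r0 k : 0 < r k by case: k => [|k]; rewrite /r /= invr_gt0 mulr_gt0.
set T := tail w b rho (r 0%N).
have T0 k : 0 < T k by case: k => [|k]; [exact: addr_gt0 | exact: rho0].
have TS k : T k.+1 = T k.+2 + r k.+1 by rewrite /T /= rhoS.
have Tc : T k @[k --> \oo] --> 0 by rewrite -cvg_shiftS.
have w0' k : 0 <= w k by exact: ltW.
have eS k : edge_energy w a b g k.+1 = (g k.+1 - g k) ^+ 2 / r k.+1.
  exact: edge_energyS.
have EE := sum_edge_energy_le DE.
have gc : g n @[n --> \oo] --> 0.
  apply: (@finite_energy_cvg0 _ w r T g (edge_energy w a b g) E C) => //.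
  rewrite /=; apply: mulr_ge0; last exact: sqr_ge0.
  by rewrite mulr_ge0// ltW.
apply: (@bilateral_hardy_convergent _ w r (fun k => \sum_(i < k.+1) r i) T g
  (edge_energy w a b g)) => //.
- by move=> k; rewrite big_ord_recl ltr_pwDl// sumr_ge0// => i _; exact: ltW.
- by move=> k; rewrite big_ord_recr.
- exact: ltW.
- by move=> i j ij; rewrite -killed_resistance; exact: HK.
- by rewrite big_ord1 /r /= invrK mulrC.
Qed.

Lemma decays_null (rho : nat -> R) (K lam : R) : a 0%N = 0 -> 0 < K ->
  (forall k, 0 < rho k) -> (forall k, rho k = rho k.+1 + (w k * b k)^-1) ->
  rho k @[k --> \oo] --> 0 -> (forall A, exists n, A < \sum_(i < n) w i) ->
  (forall n, (\sum_(0 <= i < n.+1) w i) * rho n <= K) ->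
  0 <= lam -> lam * (4 * K) < 1 -> decays q lam.
Proof.
move=> a00 K0 rho0 rhoS rhoc winf HK lam0 lamK.
apply: (decays_of_hardy K0 lam0 lamK) => g E C DE gC n.
have w0 := w_gt0 H; have b0 := b_gt0 H.
set r := resistance w b 1.
have r0 k : 0 < r k by case: k => [|k]; rewrite /r /= ?invr_gt0 ?mulr_gt0.
set T := tail w b rho (r 0%N).
have T0 k : 0 < T k by case: k => [|k]; [exact: addr_gt0 | exact: rho0].
have TS k : T k.+1 = T k.+2 + r k.+1 by rewrite /T /= rhoS.
have Tc : T k @[k --> \oo] --> 0 by rewrite -cvg_shiftS.
have w0' k : 0 <= w k by exact: ltW.
have eS k : edge_energy w a b g k.+1 = (g k.+1 - g k) ^+ 2 / r k.+1.
  exact: edge_energyS.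
have EE := sum_edge_energy_le DE.
have e0 : 0 <= edge_energy w a b g 0 by rewrite /= a00 mulr0 mul0r.
have gc : g n @[n --> \oo] --> 0.
  exact: (@finite_energy_cvg0 _ w r T g (edge_energy w a b g) E C).
(* The cut is at 0: under reflection the whole mass is compared with the boundary at infinity. *)
apply: (@hardy_right _ w r (fun k => \sum_(i < k.+1) r i) T g
  (edge_energy w a b g) K 0) => //.
- by move=> k; rewrite big_ord_recl ltr_pwDl// sumr_ge0// => i _; exact: ltW.
- by move=> k; rewrite big_ord_recr.
- exact: ltW.
- case=> [|k]; first by rewrite big_ord0 subr0 mul0r (ltW K0).
  have : 0 < \sum_(i < k.+1) w i.
    by rewrite big_ord_recl ltr_pwDl// sumr_ge0// => i _; exact: ltW.
  by lra.
- by move=> k; rewrite subr0 -(big_mkord xpredT w); exact: HK.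
- by left.
Qed.

End LowerBound.

(** * The ergodic case: Poincare inequality for the flux, and conservativeness *)

Section Ergodic.
Context {R : realType}.

(* The two-sided Hardy inequality for the flux h_k = sum_{i <= k} w_i g_i, with
   weights 1/(w b) and resistances w, combined with sum w g^2 = - sum h dg. *)
Lemma dual_poincare (w b g : nat -> R) (W K E V B : R) :
  (forall k, 0 < w k) -> (forall k, 0 < b k) -> 0 < K ->
  \sum_(i < n) w i @[n --> \oo] --> W ->
  (forall n m, (n <= m)%N -> \sum_(n <= j < m.+1) (w j * b j)^-1 <=
     K * ((\sum_(0 <= i < n.+1) w i)^-1 + (W - \sum_(0 <= i < m.+1) w i)^-1)) ->
  \sum_(i < n) w i * g i @[n --> \oo] --> 0 ->
  \sum_(i < n) w i * g i ^+ 2 @[n --> \oo] --> V ->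
  (forall i, `|g i| <= B) ->
  (forall n, \sum_(i < n) w i * b i * (g i - g i.+1) ^+ 2 <= E) ->
  V <= 4 * K * E.
Proof.
move=> w0 b0 K0 wW HK gmean gV gB gE.
pose h k := \sum_(i < k.+1) w i * g i.
have w0' k : 0 <= w k by exact: ltW.
have hc : h n @[n --> \oo] --> 0.
  by move: gmean; rewrite -cvg_shiftS.
have T0 k : 0 < W - \sum_(i < k) w i.
  rewrite subr_gt0; apply: (@lt_le_trans _ _ (\sum_(i < k.+1) w i)).
    by rewrite big_ord_recr /= ltrDl.
  exact: series_ge.
have V0 n : \sum_(i < n) w i * g i ^+ 2 <= V.
  apply: (@series_ge _ (fun i => w i * g i ^+ 2)) => // i.
  by apply: mulr_ge0 => //; exact: sqr_ge0.
have hV N : \sum_(i < N.+1) (w i * b i)^-1 * h i ^+ 2 <= 4 * K * V.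
  apply: (@bilateral_hardy_convergent _ (fun k => (w k * b k)^-1) w
    (fun k => \sum_(i < k.+1) w i) (fun k => W - \sum_(i < k) w i) h
    (fun i => w i * g i ^+ 2)) => //.
  - by move=> k; rewrite invr_ge0 mulr_ge0// ltW.
  - by move=> k; rewrite big_ord_recl ltr_pwDl// sumr_ge0.
  - by move=> k; rewrite big_ord_recr.
  - exact: ltW.
  - by move=> k; rewrite [in RHS]big_ord_recr /=; ring.
  - by move=> n m nm; have := HK n m nm; rewrite !big_mkord.
  - move=> k; have -> : h k.+1 - h k = w k.+1 * g k.+1.
      by rewrite /h [X in X - _]big_ord_recr /=; ring.
    by have w1 := w0 k.+1; field; rewrite gt_eqF.
  - rewrite /h !big_ord1 le_eqVlt; apply/orP; left; apply/eqP.
    by have w1 := w0 0%N; field; rewrite gt_eqF.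
have abel N : \sum_(i < N.+1) w i * g i ^+ 2 =
    g N * h N + \sum_(i < N) h i * (g i - g i.+1).
  elim: N => [|N IH]; first by rewrite /h !big_ord1 big_ord0; ring.
  have -> : h N.+1 = h N + w N.+1 * g N.+1 by rewrite /h [in LHS]big_ord_recr.
  by rewrite big_ord_recr /= IH [in RHS]big_ord_recr /=; ring.
(* The weight 4 K is chosen so that, by [hV], the first terms sum to at most V / 2, which is
   absorbed into V. *)
have young i : h i * (g i - g i.+1) <=
    2^-1 * ((4 * K)^-1 * ((w i * b i)^-1 * h i ^+ 2) + (4 * K) * (w i * b i * (g i - g i.+1) ^+ 2)).
  set c := w i * b i; have c0 : 0 < c by rewrite mulr_gt0.
  rewrite -subr_ge0.
  have -> : 2^-1 * ((4 * K)^-1 * (c^-1 * h i ^+ 2) + (4 * K) * (c * (g i - g i.+1) ^+ 2))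
      - h i * (g i - g i.+1) = (h i - 4 * K * c * (g i - g i.+1)) ^+ 2 / (8 * K * c).
    by field; rewrite !gt_eqF.
  by rewrite divr_ge0 ?sqr_ge0// !mulr_ge0// ltW.
have bnd N : \sum_(i < N.+1) w i * g i ^+ 2 - g N * h N <= 2^-1 * (V + 4 * K * E).
  rewrite abel addrC addKr.
  apply: (@le_trans _ _ (\sum_(i < N) 2^-1 * ((4 * K)^-1 * ((w i * b i)^-1 * h i ^+ 2)
      + (4 * K) * (w i * b i * (g i - g i.+1) ^+ 2)))).
    by apply: ler_sum => i _; exact: young.
  rewrite -mulr_sumr ler_wpM2l ?invr_ge0// big_split /= -!mulr_sumr.
  have K4 : 0 < 4 * K by rewrite mulr_gt0.
  apply: lerD; last by apply: ler_wpM2l; [exact: ltW | exact: gE].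
  rewrite mulrC ler_pdivrMr ?mulr_gt0// mulrC.
  apply: le_trans (hV N); rewrite big_ord_recr /= lerDl.
  apply: mulr_ge0; last exact: sqr_ge0.
  by rewrite invr_ge0 mulr_ge0// ltW.
have gh : g N * h N @[N --> \oo] --> 0.
  apply/norm_cvg0P.
  apply: (@squeeze_cvgr _ _ _ _ (fun=> 0) (fun N => B * `|h N|)).
  - by apply: nearW => N /=; rewrite normr_ge0 normrM ler_wpM2r.
  - exact: cvg_cst.
  - rewrite -[X in _ --> X](mulr0 B); apply: cvgM; first exact: cvg_cst.
    by apply/norm_cvg0P.
have lim : \sum_(i < N.+1) w i * g i ^+ 2 - g N * h N @[N --> \oo] --> V - 0.
  by apply: cvgB => //; move: gV; rewrite -cvg_shiftS.
have : V - 0 <= 2^-1 * (V + 4 * K * E).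
  by apply: (cvgr_to_le lim); apply: nearW.
by lra.
Qed.

Context {w a b : nat -> R} {q : nat -> nat -> R -> R} {z : R -> R}.
Hypothesis H : bd_semigroup w a b q z.
Hypothesis a00 : a 0%N = 0.

Lemma Pt0 f N i : (forall i, (N <= i)%N -> f i = 0) -> Pt q f N 0 i = f i.
Proof.
move=> f0; rewrite /Pt; under eq_bigr => j _ do rewrite (q_id H) eq_sym.
have [iN|Ni] := ltnP i N; first by rewrite sum_delta.
rewrite f0// big1// => j _; rewrite ltn_eqF ?mul0r//.
exact: leq_trans (ltn_ord j) Ni.
Qed.

(* Recurrence: the constant 1 is a limit of cutoffs of vanishing energy. *)
Lemma conservative i s : (forall A, exists n, A < \sum_(k < n) (w k * b k)^-1) ->
  0 <= s -> \sum_(k < n) q i k s @[n --> \oo] --> (1 : R).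
Proof.
move=> rinf s0; have w0 := w_gt0 H; have b0 := b_gt0 H.
have q0 k : 0 <= q i k s by exact: (q_ge0 H).
have [S qS] : exists S : R, \sum_(k < n) q i k s @[n --> \oo] --> S.
  eexists; apply: nondecreasing_cvgn.
    by move=> m n mn; exact: (@ler_sum_ord _ (fun k => q i k s) (fun k => q i k s)).
  by exists 1 => _ [n _ <-]; exact: (q_mass H).
suff S1 : S = 1 by rewrite -S1.
have SM n : \sum_(k < n) q i k s <= S by apply: (@series_ge _ (fun k => q i k s)).
have S1 : S <= 1 by apply: (cvgr_to_le qS); apply: nearW => n; exact: (q_mass H).
apply/eqP; rewrite eq_le S1 leNgt; apply/negP => S1'.
have d0 : 0 < w i * (1 - S) by rewrite mulr_gt0// subr_gt0.
have r0 k : 0 < (w k * b k)^-1 by rewrite invr_gt0 mulr_gt0.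
(* If mass 1 - S is lost from i by time s, phi of a cutoff equal to 1 at i drops by at least w_i (1
   - S), but by at most s divided by the resistance. A is the resistance at which the two bounds
   meet. *)
pose A := s / (w i * (1 - S)).
have [m Hm] := rinf (\sum_(0 <= k < i) (w k * b k)^-1 + A).
have A0 : 0 <= A by rewrite divr_ge0// ltW.
have im : (i < m)%N.
  rewrite ltnNge; apply/negP => mi; move: Hm; apply/negP; rewrite -leNgt.
  rewrite -[leLHS]addr0 lerD// big_mkord.
  by apply: (@ler_sum_ord _ (fun k => (w k * b k)^-1) (fun k => (w k * b k)^-1)) => // k;
    exact: ltW.
have {Hm} Ar : A < \sum_(i <= k < m) (w k * b k)^-1.
  move: Hm; rewrite -(big_mkord xpredT (fun k => (w k * b k)^-1)).
  by rewrite (@big_cat_nat _ _ _ i 0%N m)//= ?(ltnW im)// ltrD2l.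
have [f [f1 f0 fD]] := cutoff H a00 im.
set r := \sum_(i <= k < m) _ in Ar fD.
have rp : 0 < r by exact: le_lt_trans Ar.
have up : phi w q f m 0 - phi w q f m s <= s / r.
  move: s0; rewrite le_eqVlt => /orP[/eqP <-|s0]; first by rewrite subrr mul0r.
  by rewrite -fD; exact: (phi_drop_le H).
have := @phi_drop _ _ _ _ _ _ H f m (fun k => if k == i then 1 - S else 0) _ _ i.+1
  s0 (lexx 0) _ _.
rewrite !addr0 add0r => low.
have {low} low : w i * (1 - S) <= phi w q f m 0 - phi w q f m s.
  apply: le_trans (low _ _); last first.
  - move=> k n; case: ifPn => [/eqP ->|_]; last by rewrite addr0 (q_mass H).
    by move: (SM n); lra.
  - by move=> k; case: ifP => // _; rewrite subr_ge0.
  rewrite [X in _ <= _ + X]big_ord_recr /= eqxx Pt0// f1// expr1n mulr1 addrA lerDr addr_ge0//.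
    rewrite mulr_ge0 ?invr_ge0// sumr_ge0// => k _; rewrite sumr_ge0// => l _.
    by apply: mulr_ge0; [rewrite mulr_ge0 ?(q_ge0 H)// ltW | exact: sqr_ge0].
  apply: sumr_ge0 => k _; apply: mulr_ge0; last exact: sqr_ge0.
  by rewrite mulr_ge0 ?(ltW (w0 _))//; case: ifP => // _; rewrite subr_ge0.
have := le_trans low up; apply/negP; rewrite -ltNge ltr_pdivrMr//.
by rewrite mulrC -ltr_pdivrMr.
Qed.

(** Symmetry reduces invariance of the mean to conservativeness from each j < N. *)
Lemma Pt_mean f N t : (forall A, exists n, A < \sum_(k < n) (w k * b k)^-1) ->
  0 <= t -> \sum_(i < n) w i * Pt q f N t i @[n --> \oo] --> \sum_(j < N) w j * f j.
Proof.
move=> rinf t0.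
have E n : \sum_(i < n) w i * Pt q f N t i =
    \sum_(j < N) w j * f j * \sum_(i < n) q j i t.
  under [RHS]eq_bigr => j _ do rewrite mulr_sumr.
  rewrite exchange_big; apply: eq_bigr => i _ /=.
  rewrite /Pt mulr_sumr; apply: eq_bigr => j _.
  by rewrite mulrA (q_sym H)//; ring.
under eq_fun do rewrite E.
apply: (@cvg_sum_ord _ _ _ _ _ (fun j n => w j * f j * \sum_(i < n) q j i t)
  (fun j => w j * f j)) => j _.
rewrite -[X in _ --> X]mulr1; apply: cvgM; first exact: cvg_cst.
exact: conservative.
Qed.

Lemma decays_ergodic (W K lam : R) : 0 < K ->
  \sum_(i < n) w i @[n --> \oo] --> W ->
  (forall A, exists n, A < \sum_(k < n) (w k * b k)^-1) ->
  (forall n m, (n <= m)%N -> \sum_(n <= j < m.+1) (w j * b j)^-1 <=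
     K * ((\sum_(0 <= i < n.+1) w i)^-1 + (W - \sum_(0 <= i < m.+1) w i)^-1)) ->
  0 <= lam -> lam * (4 * K) < 1 -> decays q lam.
Proof.
move=> K0 wW rinf HK lam0 lamK.
have w0 := w_gt0 H; have b0 := b_gt0 H.
have W0 : 0 < W.
  apply: (@lt_le_trans _ _ (w 0%N)) => //.
  have := @series_ge _ w W (fun k => ltW (w0 k)) wW 1%N.
  by rewrite big_ord1.
apply: (@decays_of_poincare _ _ _ _ _ _ H (4 * K)) => //; first by rewrite mulr_gt0.
move=> f N; set m := \sum_(j < N) w j * f j.
(* The squared norm of the constant m / W, the projection of f on constants; by invariance of the
   mean, phi(2t) - m^2 / W is the squared norm of P_t f - m / W. *)
exists (m ^+ 2 / W).
have lim t : 0 <= t -> \sum_(i < n) w i * (Pt q f N t i - m / W) ^+ 2 @[n --> \oo]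
    --> phi w q f N (t + t) - m ^+ 2 / W.
  move=> t0.
  have -> : phi w q f N (t + t) - m ^+ 2 / W =
    phi w q f N (t + t) - 2 * (m / W) * m + (m / W) ^+ 2 * W by field; rewrite gt_eqF.
  have E n : \sum_(i < n) w i * (Pt q f N t i - m / W) ^+ 2 =
    \sum_(i < n) w i * Pt q f N t i * Pt q f N t i
    - 2 * (m / W) * (\sum_(i < n) w i * Pt q f N t i) + (m / W) ^+ 2 * \sum_(i < n) w i.
    by rewrite !mulr_sumr -sumrB -big_split /=; apply: eq_bigr => i _; ring.
  under eq_fun do rewrite E.
  apply: cvgD; last by apply: cvgM; [exact: cvg_cst | exact: wW].
  apply: cvgB; first exact: (PtM_cvg H).
  by apply: cvgM; [exact: cvg_cst | exact: Pt_mean].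
split=> [t t0|t E t0 DE].
  have t20 : 0 <= t / 2 by rewrite divr_ge0.
  rewrite -subr_ge0 (splitr t); apply: (cvgr_to_ge (lim _ t20)); apply: nearW => n.
  by apply: sumr_ge0 => i _; apply: mulr_ge0; [exact: ltW | exact: sqr_ge0].
apply: (@dual_poincare w b (fun i => Pt q f N t i - m / W) W K E _
  (\sum_(j < N) `|f j| + `|m / W|) w0 b0 K0 wW HK _ (lim t t0)).
- have Z : m - m / W * W = 0 by field; rewrite gt_eqF.
  rewrite -[X in _ --> X]Z.
  have E' n : \sum_(i < n) w i * (Pt q f N t i - m / W) =
      \sum_(i < n) w i * Pt q f N t i - m / W * \sum_(i < n) w i.
    by rewrite mulr_sumr -sumrB; apply: eq_bigr => i _; ring.
  rewrite /=; under eq_fun do rewrite E'.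
  apply: cvgB; first exact: Pt_mean.
  by apply: cvgM; [exact: cvg_cst | exact: wW].
- move=> i; apply: le_trans (ler_normB _ _) _; rewrite lerD2r.
  apply: le_trans (ler_norm_sum _ _ _) _; apply: ler_sum => j _.
  rewrite normrM ger0_norm ?(q_ge0 H)//.
  rewrite -[leRHS]mul1r ler_wpM2r//.
  apply: le_trans (q_mass H i j.+1 t0).
  rewrite big_ord_recr /= lerDr sumr_ge0// => k _; exact: (q_ge0 H).
- move=> n; have := DE n; rewrite /Dform a00 mulr0 mul0r add0r.
  apply: le_trans; rewrite le_eqVlt; apply/orP; left; apply/eqP.
  by apply: eq_bigr => i _; congr (_ * _ ^+ 2); ring.
Qed.

End Ergodic.

(** * The constants kappa and delta *)

Section ExtendedSums.
Context {R : realType}.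
Implicit Types (u : nat -> R) (m n M : nat).

Lemma nneseries_leP u m (C : R) : (forall i, (m <= i)%N -> 0 <= u i) ->
  (\sum_(m <= i <oo) (u i)%:E <= C%:E)%E <-> forall n, \sum_(m <= i < n) u i <= C.
Proof.
move=> u0; split=> [uC n|uC].
  rewrite -lee_fin -sumEFin; apply: le_trans uC.
  by apply: nneseries_lim_ge => i mi _; rewrite lee_fin u0.
apply: lime_le.
  by apply: is_cvg_nneseries => i mi _; rewrite lee_fin u0.
by apply: nearW => n; rewrite sumEFin lee_fin.
Qed.

Lemma nneseries_cvg u m (S : R) : (forall i, (m <= i)%N -> 0 <= u i) ->
  (\sum_(m <= i <oo) (u i)%:E = S%:E)%E ->
  \sum_(m <= i < n) u i @[n --> \oo] --> S.
Proof.
move=> u0 uS.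
have : (\sum_(m <= i < n) (u i)%:E @[n --> \oo] --> S%:E)%E.
  by rewrite -uS; apply: is_cvg_nneseries => i mi _; rewrite lee_fin u0.
move/fine_cvg; apply: cvg_trans; apply: near_eq_cvg.
by apply: nearW => n; rewrite /= sumEFin.
Qed.

Lemma nneseries_unbounded u m : (forall i, (m <= i)%N -> 0 <= u i) ->
  (\sum_(m <= i <oo) (u i)%:E = +oo)%E <->
  forall A, exists n, A < \sum_(m <= i < n) u i.
Proof.
move=> u0; split=> [uy A|uA].
  apply/not_existsP => uA; have : (\sum_(m <= i <oo) (u i)%:E <= A%:E)%E.
    by apply/nneseries_leP => // n; rewrite leNgt; apply/negP; exact: uA.
  by rewrite uy leye_eq.
apply/eqP; rewrite -leye_eq leNgt; apply/negP => uy.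
have u0' : (0 <= \sum_(m <= i <oo) (u i)%:E)%E.
  by apply: nneseries_ge0 => i mi _; rewrite lee_fin u0.
have uf : (\sum_(m <= i <oo) (u i)%:E)%E \is a fin_num by rewrite ge0_fin_numE.
have [n] := uA (fine (\sum_(m <= i <oo) (u i)%:E)%E); apply/negP; rewrite -leNgt.
by move: n; apply/nneseries_leP => //; rewrite fineK.
Qed.

Lemma nneseries_fin u m : (forall i, (m <= i)%N -> 0 <= u i) ->
  (\sum_(m <= i <oo) (u i)%:E < +oo)%E -> exists S : R, (\sum_(m <= i <oo) (u i)%:E = S%:E)%E.
Proof.
move=> u0 uy; exists (fine (\sum_(m <= i <oo) (u i)%:E)%E); rewrite fineK// ge0_fin_numE//.
by apply: nneseries_ge0 => i mi _; rewrite lee_fin u0.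
Qed.

Lemma kappa_term_ge u m (X Y y : R) : 0 < X -> 0 < Y -> (forall i, (m <= i)%N -> 0 < u i) ->
  (y%:E <= ((Y%:E)^-1 + (\sum_(m <= i <oo) (u i)%:E)^-1) * (X%:E)^-1)%E <->
  forall M, (m < M)%N -> y * X <= Y^-1 + (\sum_(m <= i < M) u i)^-1.
Proof.
move=> X0 Y0 u0.
have u0' i : (m <= i)%N -> 0 <= u i by move=> mi; rewrite ltW// u0.
have s0 M : (m < M)%N -> 0 < \sum_(m <= i < M) u i.
  move=> mM; rewrite big_ltn// ltr_pwDl ?u0// big_nat sumr_ge0// => i /andP[mi _].
  by rewrite u0' // ltnW.
have t0 : (0 <= \sum_(m <= i <oo) (u i)%:E)%E.
  by apply: nneseries_ge0 => i mi _; rewrite lee_fin u0'.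
rewrite (inver X) gt_eqF// lee_pdivlMr// (inver Y) gt_eqF// -EFinM -leeBlDl// -EFinB.
set c := y * X - Y^-1.
have E M : (y * X <= Y^-1 + (\sum_(m <= i < M) u i)^-1) =
    (c <= (\sum_(m <= i < M) u i)^-1) by rewrite lerBlDl.
(* For c <= 0 both sides hold trivially; for c > 0 inversion turns the condition into an upper bound
   1 / c on the series, equivalent to the same bound on its partial sums. *)
have [c0|c0] := leP c 0.
  split=> _; last by apply: (@le_trans _ _ 0%E); rewrite ?lee_fin// inve_ge0.
  by move=> M mM; rewrite E (le_trans c0)// invr_ge0 ltW// s0.
have cE : (c%:E <= (\sum_(m <= i <oo) (u i)%:E)^-1)%E =
    (\sum_(m <= i <oo) (u i)%:E <= (c^-1)%:E)%E.
  by rewrite inve_pge ?inE ?lee_fin ?(ltW c0)// inver gt_eqF.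
rewrite cE; split=> [/nneseries_leP uc M mM|uc].
  by rewrite E -[c]invrK lef_pV2 ?posrE ?invr_gt0 ?s0// uc.
apply/nneseries_leP => // n; have [mn|nm] := ltnP m n.
  by rewrite -[leLHS]invrK lef_pV2 ?posrE ?invr_gt0 ?s0// -E uc.
by rewrite big_geq// invr_ge0 ltW.
Qed.

Lemma kappa_ge (D : set (nat * nat)) u (X : nat * nat -> R) (Y : nat -> R) (y : R) :
  (forall nm, D nm -> 0 < X nm) -> (forall nm, D nm -> 0 < Y nm.1) ->
  (forall nm i, D nm -> (nm.2 <= i)%N -> 0 < u i) ->
  (y%:E <= ereal_inf [set (((Y nm.1)%:E)^-1 + (\sum_(nm.2 <= i <oo) (u i)%:E)^-1) *
                 ((X nm)%:E)^-1 | nm in D])%E <->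
  forall nm M, D nm -> (nm.2 < M)%N -> y * X nm <= (Y nm.1)^-1 + (\sum_(nm.2 <= i < M) u i)^-1.
Proof.
move=> X0 Y0 u0; split=> [yI nm M Dnm mM|yI].
  apply: (kappa_term_ge y (X0 _ Dnm) (Y0 _ Dnm) (fun i => u0 nm i Dnm)).1 => //.
  by apply: le_trans yI _; apply: ereal_inf_lbound; exists nm.
apply: le_ereal_inf_tmp => _ [nm Dnm <-].
apply/(kappa_term_ge y (X0 _ Dnm) (Y0 _ Dnm) (fun i => u0 nm i Dnm)) => M.
exact: yI.
Qed.

Lemma kappa_fin (D : set (nat * nat)) u (X : nat * nat -> R) (Y : nat -> R) :
  D !=set0 ->
  (forall nm, D nm -> 0 < X nm) -> (forall nm, D nm -> 0 < Y nm.1) ->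
  (forall nm i, D nm -> (nm.2 <= i)%N -> 0 < u i) ->
  (ereal_inf [set (((Y nm.1)%:E)^-1 + (\sum_(nm.2 <= i <oo) (u i)%:E)^-1) *
                 ((X nm)%:E)^-1 | nm in D])%E \is a fin_num.
Proof.
move=> [nm Dnm] X0 Y0 u0; set I := ereal_inf _.
have I0 : (0 <= I)%E.
  apply/(kappa_ge 0 X0 Y0 u0) => nm' M D' mM; rewrite mul0r addr_ge0 ?invr_ge0 ?(ltW (Y0 _ D'))//.
  by rewrite big_nat sumr_ge0// => i /andP[mi _]; rewrite ltW// (u0 nm').
rewrite ge0_fin_numE//; rewrite ltey; apply/eqP => Iy.
pose y := ((Y nm.1)^-1 + (\sum_(nm.2 <= i < nm.2.+1) u i)^-1) / X nm + 1.
have : (y%:E <= I)%E by rewrite Iy leey.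
move/(kappa_ge y X0 Y0 u0) => /(_ nm nm.2.+1 Dnm (leqnn _)).
rewrite /y mulrDl mulfVK ?gt_eqF ?X0// mul1r gerDl leNgt => /negP; apply.
exact: X0.
Qed.

Lemma delta_fin (D : set nat) (A u : nat -> R) :
  (forall n, D n -> 0 < A n) -> (forall n i, D n -> (n <= i)%N -> 0 <= u i) ->
  (ereal_sup [set (A n)%:E * \sum_(n <= j <oo) (u j)%:E | n in D] < +oo)%E <->
  exists C : R, forall n N, D n -> A n * \sum_(n <= j < N) u j <= C.
Proof.
move=> A0 u0; have E n (C : R) : D n ->
    ((A n)%:E * \sum_(n <= j <oo) (u j)%:E <= C%:E)%E <->
    forall N, A n * \sum_(n <= j < N) u j <= C.
  move=> Dn; rewrite muleC -lee_pdivlMr ?A0// -EFinM.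
  rewrite (nneseries_leP _ (fun i => u0 n i Dn)); split=> uC N; have := uC N.
    by rewrite ler_pdivlMr ?A0// mulrC.
  by rewrite ler_pdivlMr ?A0// mulrC.
split=> [|[C HC]]; last first.
  apply: le_lt_trans (ltry C); apply: ge_ereal_sup => _ [n Dn <-].
  by apply/(E n C Dn) => N; exact: HC.
set s := ereal_sup _ => sy.
have [C sC] : exists C : R, (s <= C%:E)%E.
  by case: s sy => [r| |] // _; [exists r; rewrite lexx | exists 0; rewrite leNye].
exists C => n N Dn; apply: (E n C Dn).1; apply: le_trans sC.
by apply: ereal_sup_ubound; exists n.
Qed.

End ExtendedSums.

(** * Comparison of kappa with the one-sided constants delta *)

Section Criterion.
Context {R : realType}.
Implicit Types (u v A : nat -> R) (t : nat -> nat).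

Definition unbounded_series u := forall A : R, exists n, A < \sum_(k < n) u k.

Lemma series_dichotomy u : (forall k, 0 <= u k) ->
  (exists S : R, \sum_(k < n) u k @[n --> \oo] --> S) \/ unbounded_series u.
Proof.
move=> u0; have [ub|nub] := pselect (exists B : R, forall n, \sum_(k < n) u k <= B).
  left; have [B HB] := ub; eexists; apply: nondecreasing_cvgn.
    by move=> m n mn; exact: (@ler_sum_ord _ u u).
  by exists B => _ [n _ <-].
right=> A; apply/not_existsP => uA; apply: nub; exists A => n.
by rewrite leNgt; apply/negP; exact: uA.
Qed.

Lemma sum_nat_split u m n : (m <= n)%N ->
  \sum_(k < n) u k = \sum_(k < m) u k + \sum_(m <= k < n) u k.
Proof. by move=> mn; rewrite -!(big_mkord xpredT u) -big_cat_nat. Qed.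

Lemma inv_tail_unbounded u m (x c : R) : (forall k, 0 < u k) -> unbounded_series u ->
  (forall M, (m < M)%N -> x <= c + (\sum_(m <= k < M) u k)^-1) -> x <= c.
Proof.
move=> u0 uinf xM; rewrite leNgt; apply/negP => cx.
have d0 : 0 < (x - c)^-1 by rewrite invr_gt0 subr_gt0.
have [M HM] := uinf (\sum_(k < m) u k + (x - c)^-1).
have mM : (m < M)%N.
  rewrite ltnNge; apply/negP => Mm; move: HM; apply/negP; rewrite -leNgt.
  rewrite -[leLHS]addr0 lerD ?(ltW d0)//.
  by apply: (@ler_sum_ord _ u u) => // k; exact: ltW.
have := xM M mM; move: HM; rewrite (sum_nat_split u (ltnW mM)) ltrD2l => HM.
rewrite -lerBlDl -[x - c]invrK lef_pV2 ?posrE//; last exact: lt_trans HM.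
by rewrite leNgt HM.
Qed.

Lemma inv_tail_cvg u m (x c S : R) : (forall k, 0 < u k) ->
  \sum_(k < n) u k @[n --> \oo] --> S ->
  (forall M, (m < M)%N -> x <= c + (\sum_(m <= k < M) u k)^-1) ->
  x <= c + (S - \sum_(k < m) u k)^-1.
Proof.
move=> u0 uS xM.
have T0 : 0 < S - \sum_(k < m) u k.
  rewrite subr_gt0; apply: (@lt_le_trans _ _ (\sum_(k < m.+1) u k)).
    by rewrite big_ord_recr /= ltrDl.
  by apply: series_ge => // k; exact: ltW.
have lim : c + (\sum_(k < M) u k - \sum_(k < m) u k)^-1 @[M --> \oo] -->
    c + (S - \sum_(k < m) u k)^-1.
  apply: cvgD; first exact: cvg_cst.
  apply: cvgV; first by rewrite gt_eqF.
  by apply: cvgB => //; exact: cvg_cst.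
apply: (cvgr_to_ge lim); near=> M.
have mM : (m < M)%N by near: M; exact: nbhs_infty_gt.
rewrite (sum_nat_split u (ltnW mM)) [X in _ + X^-1]addrAC subrr add0r.
exact: xM.
Unshelve. all: by end_near. Qed.

Lemma series_remainder u (S : R) (rho := fun k => S - \sum_(i < k) u i) :
  (forall k, 0 < u k) -> \sum_(k < n) u k @[n --> \oo] --> S ->
  [/\ forall k, 0 < rho k, forall k, rho k = rho k.+1 + u k & rho k @[k --> \oo] --> 0].
Proof.
move=> u0 uS; split=> [k|k|].
- rewrite subr_gt0; apply: (@lt_le_trans _ _ (\sum_(i < k.+1) u i)).
    by rewrite big_ord_recr /= ltrDl.
  by apply: series_ge => // i; exact: ltW.
- by rewrite /rho big_ord_recr /=; ring.
- by rewrite -(subrr S); apply: cvgB => //; exact: cvg_cst.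
Qed.

(* The condition [y <= 1/kappa], written with partial sums: in the absorbing
   case u = mu, v = 1/(mu b), t m = m; in the reflecting case u = 1/(mu b),
   v = mu, t m = m + 1. *)
Definition kappa_bound A u v t (y : R) := forall n m M, (n <= m)%N -> (t m < M)%N ->
  y * \sum_(n <= j < m.+1) u j <= (A n)^-1 + (\sum_(t m <= i < M) v i)^-1.

(** Infinite tails of v have inverse 0, which leaves y sum u <= 1 / A_n. This gives delta1 under
    absorption with finite mu, and delta2 under reflection with infinite mu. *)
Lemma kappa_bound_one_sided A u v t : (forall n, 0 < A n) -> (forall n, 0 < u n) ->
  (forall n, 0 < v n) -> unbounded_series v ->
  (exists2 y, 0 < y & kappa_bound A u v t y) <->
  exists C : R, forall n N, A n * \sum_(n <= j < N) u j <= C.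
Proof.
move=> A0 u0 v0 vinf; split=> [[y y0 Qy]|[C HC]].
  exists y^-1 => n N; have [Nn|nN] := leqP N n.
    by rewrite big_geq// mulr0 invr_ge0 ltW.
  case: N nN => // N nN; rewrite mulrC -ler_pdivlMr// -(ler_pM2l y0) mulrA divff ?gt_eqF// mul1r.
  apply: (inv_tail_unbounded v0 vinf (m := t N)) => M tM.
  exact: Qy.
pose C' := Num.max C 1; have C'0 : 0 < C' by rewrite lt_max ltr01 orbT.
exists C'^-1; first by rewrite invr_gt0.
move=> n m M nm tM; apply: (@le_trans _ _ (A n)^-1); last first.
  by rewrite lerDl invr_ge0 big_nat sumr_ge0// => i _; exact: ltW.
rewrite mulrC ler_pdivrMr// mulrC ler_pdivlMr// mulrC.
by apply: le_trans (HC n m.+1) _; rewrite le_max lexx.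
Qed.

(** Divergence of u makes n = 0 decisive. A divergent v would bound the partial sums of u, so v has
    a finite sum B; multiplying the condition by a tail V <= B gives y U V <= B / A_0 + 1. This
    covers delta2 under absorption with infinite mu, and delta1 under reflection with finite mu. *)
Lemma kappa_bound_unbounded A u v t : (forall n, 0 < A n) -> (forall n, 0 < u n) ->
  (forall n, 0 < v n) -> unbounded_series u ->
  (exists2 y, 0 < y & kappa_bound A u v t y) <->
  exists C : R, forall m N, (\sum_(0 <= j < m.+1) u j) * \sum_(t m <= i < N) v i <= C.
Proof.
move=> A0 u0 v0 uinf.
have u0' k : 0 <= u k by exact: ltW.
have v0' k : 0 <= v k by exact: ltW.
split=> [[y y0 Qy]|[C HC]].
  have [[B vB]|vinf] := series_dichotomy v0'; last first.
    have [n Hn] := uinf ((A 0%N)^-1 / y); exfalso; move: Hn; apply/negP; rewrite -leNgt.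
    rewrite ler_pdivlMr// mulrC.
    apply: (@le_trans _ _ (y * \sum_(0 <= j < n.+1) u j)).
      by rewrite ler_pM2l// big_mkord; apply: (@ler_sum_ord _ u u).
    by apply: (inv_tail_unbounded v0 vinf (m := t n)) => M tM; exact: Qy.
  have vB' := series_ge v0' vB.
  have B0 : 0 <= B by have := vB' 0%N; rewrite big_ord0.
  have C0 : 0 <= (B / A 0%N + 1) / y.
    by rewrite divr_ge0 ?(ltW y0)// addr_ge0// divr_ge0// ltW.
  exists ((B / A 0%N + 1) / y) => m N; have [Nt|tN] := leqP N (t m).
    by rewrite [X in _ * X]big_geq// mulr0.
  set U := \sum_(0 <= j < m.+1) u j; set V := \sum_(t m <= i < N) v i.
  have V0 : 0 < V by rewrite /V big_ltn// ltr_pwDl// sumr_ge0.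
  have VB : V <= B.
    apply: le_trans (vB' N); rewrite (sum_nat_split v (ltnW tN)) lerDr.
    exact: sumr_ge0.
  have := Qy 0%N m N (leq0n _) tN; rewrite -/U -/V => yU.
  rewrite ler_pdivlMr// mulrC mulrA.
  apply: (@le_trans _ _ (((A 0%N)^-1 + V^-1) * V)); first by rewrite ler_pM2r.
  by rewrite mulrDl mulVf ?gt_eqF// lerD2r mulrC ler_pM2r ?invr_gt0.
pose C' := Num.max C 1; have C'0 : 0 < C' by rewrite lt_max ltr01 orbT.
exists C'^-1; first by rewrite invr_gt0.
move=> n m M nm tM; set V := \sum_(t m <= i < M) v i.
have V0 : 0 < V by rewrite /V big_ltn// ltr_pwDl// sumr_ge0.
apply: (@le_trans _ _ V^-1); last by rewrite lerDr invr_ge0 ltW.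
rewrite mulrC ler_pdivrMr// mulrC ler_pdivlMr//.
apply: (@le_trans _ _ C); last by rewrite le_max lexx.
apply: le_trans (HC m M); rewrite ler_pM2r//.
rewrite [leRHS](@big_cat_nat _ _ _ n)//=; last exact: leqW.
by rewrite lerDr sumr_ge0.
Qed.

Lemma rate_bounds (S : set R) (I : \bar R) (Q : R -> Prop) :
  I \is a fin_num -> (forall y, y%:E <= I <-> Q y)%E -> Q 0 -> S 0 ->
  (forall alpha, 0 < alpha -> S alpha -> Q alpha) ->
  (forall y lam, 0 < y -> Q y -> 0 <= lam -> lam < y / 4 -> S lam) ->
  let rate := ereal_sup [set alpha%:E | alpha in S] in
  (0 < rate <-> exists2 y, (0 < y)%R & Q y)%E /\
  ((4%:E * I^-1)^-1 <= rate <= (I^-1)^-1)%E.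
Proof.
move=> If IQ Q0 S0 SQ QS rate.
have rate0 : (0 <= rate)%E by apply: ereal_sup_ubound; exists 0.
have rateI : (rate <= I)%E.
  apply: ge_ereal_sup => _ [alpha Sa <-].
  have [a0|a0] := leP alpha 0; first by apply: (@le_trans _ _ 0%E); [rewrite lee_fin | exact/IQ].
  exact/IQ/SQ.
have lower y : 0 < y -> Q y -> ((y / 4)%:E <= rate)%E.
  move=> y0 Qy; rewrite leNgt; apply/negP => ry.
  have rf : rate \is a fin_num by rewrite ge0_fin_numE// (lt_trans ry)// ltry.
  move: ry rate0; rewrite -(fineK rf) lte_fin lee_fin => ry r0.
  (* The midpoint of the rate and y / 4 lies in S, yet exceeds the rate. *)
  have : ((((fine rate + y / 4) / 2)%R)%:E <= rate)%E.
    by apply: ereal_sup_ubound; eexists; last reflexivity; apply: (QS y) => //; lra.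
  by rewrite -(fineK rf) lee_fin; lra.
split; first split=> [r0|[y y0 Qy]].
- exists (fine I); last by apply/IQ; rewrite fineK.
  by rewrite -lte_fin fineK//; exact: lt_le_trans rateI.
- by apply: lt_le_trans (lower y y0 Qy); rewrite lte_fin; lra.
move: IQ rateI If; case: I => // y IQ rateI _.
have y0 : 0 <= y by rewrite -lee_fin; exact/IQ.
(* Here kappa is +oo: both bounds are 0. *)
have [y00|yn0] := eqVneq y 0.
  by move: rateI; rewrite y00 !inve0 gt0_muley ?lte_fin// invey rate0 => ->.
have yp : 0 < y by rewrite lt0r yn0.
rewrite [(y%:E)^-1%E]inver (negbTE yn0) -EFinM !inver mulf_eq0 invr_eq0 (negbTE yn0) orbF.
rewrite pnatr_eq0 /= invrK rateI andbT invfM invrK mulrC lower//.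
exact/IQ.
Qed.

End Criterion.

(** * Decay from the kappa condition, according to which series diverges *)

Section Lower.
Context {R : realType}.
Context {w a b : nat -> R} {q : nat -> nat -> R -> R} {z : R -> R}.
Hypothesis H : bd_semigroup w a b q z.
Hypothesis total_unbounded : unbounded_series (fun k => (w k * b k)^-1 + w k).

Let r k := (w k * b k)^-1.
Let Aabs n := \sum_(0 <= i < n.+1) (w i * a i)^-1.
Let Aref n := \sum_(0 <= i < n.+1) w i.

Lemma total_unbounded_or (S S' : R) : \sum_(k < n) r k @[n --> \oo] --> S ->
  \sum_(k < n) w k @[n --> \oo] --> S' -> False.
Proof.
move=> rS wS; have w0 k : 0 <= w k by rewrite ltW// (w_gt0 H).
have r0 k : 0 <= r k by rewrite invr_ge0 mulr_ge0// ltW// (b_gt0 H).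
have [n] := total_unbounded (S + S'); apply/negP; rewrite -leNgt big_split /=.
by apply: lerD; [exact: (series_ge r0 rS) | exact: (series_ge w0 wS)].
Qed.

(** Mere convergence is decay at rate 0; it makes the convergence rate nonnegative. *)
Lemma decays0 : decays q 0.
Proof.
move=> i j; exists 1; have /cvgrPdist_le/(_ 1 ltr01) := @limit_prob_cvg _ _ _ _ _ _ H i j.
move=> qn; near=> t; rewrite oppr0 mul0r expR0 mulr1 distrC.
by near: t.
Unshelve. all: by end_near. Qed.

Lemma decays_absorbing y lam : 0 < a 0%N -> 0 < y -> kappa_bound Aabs w r id y ->
  0 <= lam -> lam < y / 4 -> decays q lam.
Proof.
move=> a00 y0 Qy lam0 lamy.
have w0 := w_gt0 H; have b0 := b_gt0 H.
have r0 k : 0 < r k by rewrite invr_gt0 mulr_gt0.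
have K0 : 0 < y^-1 by rewrite invr_gt0.
have lamK : lam * (4 * y^-1) < 1 by rewrite mulrA ltr_pdivrMr// mul1r -ltr_pdivlMr.
have [[S rS]|rinf] := series_dichotomy (fun k => ltW (r0 k)).
  have [//|winf] := series_dichotomy (fun k => ltW (w0 k)).
    by move=> [S' wS]; have := total_unbounded_or rS wS.
  have [rho0 rhoS rhoc] := series_remainder r0 rS.
  apply: (decays_killed_transient H a00 K0 rho0 rhoS rhoc winf) => // n m nm.
  rewrite -(ler_pM2l y0) mulrA divff ?gt_eqF// mul1r.
  by apply: (inv_tail_cvg r0 rS) => M mM; exact: Qy.
apply: (decays_killed_recurrent H a00 K0) => // n m nm.
rewrite -(ler_pM2l y0) mulrA divff ?gt_eqF// mul1r.
by apply: (inv_tail_unbounded r0 rinf (m := m)) => M mM; exact: Qy.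
Qed.

Lemma decays_reflecting y lam : a 0%N = 0 -> 0 < y -> kappa_bound Aref r w succn y ->
  0 <= lam -> lam < y / 4 -> decays q lam.
Proof.
move=> a00 y0 Qy lam0 lamy.
have w0 := w_gt0 H; have b0 := b_gt0 H.
have r0 k : 0 < r k by rewrite invr_gt0 mulr_gt0.
have A0 n : 0 < Aref n.
  by rewrite /Aref big_ltn// ltr_pwDl// sumr_ge0// => i _; exact: ltW.
have K0 : 0 < y^-1 by rewrite invr_gt0.
have lamK : lam * (4 * y^-1) < 1 by rewrite mulrA ltr_pdivrMr// mul1r -ltr_pdivlMr.
have [[W wW]|winf] := series_dichotomy (fun k => ltW (w0 k)).
  have [//|rinf] := series_dichotomy (fun k => ltW (r0 k)).
    by move=> [S rS]; have := total_unbounded_or rS wW.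
  apply: (decays_ergodic H a00 K0 wW rinf) => // n m nm.
  rewrite -(ler_pM2l y0) mulrA divff ?gt_eqF// mul1r [X in W - X]big_mkord.
  by apply: (inv_tail_cvg w0 wW) => M mM; exact: Qy.
have Qr n m : (n <= m)%N -> y * \sum_(n <= j < m.+1) r j <= (Aref n)^-1.
  by move=> nm; apply: (inv_tail_unbounded w0 winf (m := m.+1)) => M mM; exact: Qy.
(* Null recurrence, where both series diverge, contradicts y > 0: the condition at n = 0 bounds the
   partial sums of r. *)
have [[S rS]|rinf] := series_dichotomy (fun k => ltW (r0 k)); last first.
  have [n Hn] := rinf ((Aref 0%N)^-1 / y); exfalso; move: Hn; apply/negP; rewrite -leNgt.
  rewrite ler_pdivlMr// mulrC; apply: le_trans (Qr 0%N n _) => //.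
  rewrite ler_pM2l// big_mkord; apply: (@ler_sum_ord _ r r) => // k; exact: ltW.
have [rho0 rhoS rhoc] := series_remainder r0 rS.
apply: (decays_null H a00 K0 rho0 rhoS rhoc winf) => // n.
rewrite mulrC -ler_pdivlMr; last exact: A0.
have lim : \sum_(k < m) r k - \sum_(k < n) r k @[m --> \oo] --> S - \sum_(k < n) r k.
  by apply: cvgB => //; exact: cvg_cst.
apply: (cvgr_to_le lim); near=> m.
have nm : (n < m)%N by near: m; exact: nbhs_infty_gt.
rewrite (sum_nat_split r (ltnW nm)) addrAC subrr add0r.
have m0 : (0 < m)%N by exact: leq_ltn_trans (leq0n n) nm.
rewrite -(ler_pM2l y0) mulrA divff ?gt_eqF// mul1r.
have Q := Qr n m.-1; rewrite (prednK m0) in Q; apply: Q.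
by rewrite -ltnS (prednK m0).
Unshelve. all: by end_near. Qed.

End Lower.

(** * Reduction to the state space nat *)

Section Reduction.
Context {R : realType}.
Variables (a b : nat -> R) (p : nat -> nat -> R -> R).
Hypothesis a0 : a 0%N = 0.
Hypothesis a_gt0 : forall i, (1 <= i)%N -> 0 < a i.
Hypothesis b_pos : forall i, (1 <= i)%N -> 0 < b i.
Hypothesis p_process : bd_process a b p.

Lemma bd_mu_balance n : (bd_first b <= n)%N ->
  bd_mu a b n.+1 * a n.+1 = bd_mu a b n * b n.
Proof.
move=> en; rewrite /bd_mu big_nat_recr//= [in LHS](big_nat_recr n.+1)//=.
set B := \prod_(_ <= i < n) _; set A := \prod_(_.+1 <= i < n.+1) _.
have A0 : A != 0.
  rewrite /A big_nat gt_eqF// prodr_gt0// => i /andP[ei _].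
  by rewrite a_gt0// (leq_trans _ ei).
have a1 : a n.+1 != 0 by rewrite gt_eqF// a_gt0.
by field; rewrite ?A0 ?a1.
Qed.

Lemma bd_mu_gt0 n : 0 <= b 0%N -> (bd_first b <= n)%N -> 0 < bd_mu a b n.
Proof.
move=> b00 en; rewrite /bd_mu divr_gt0// big_nat prodr_gt0// => i /andP[ei _].
  move: ei; rewrite /bd_first; case: eqP => [_ i1|b0 _]; first exact: b_pos.
  case: i => [|i]; last exact: b_pos.
  by rewrite lt0r b00 andbT; apply/eqP.
by rewrite a_gt0// (leq_trans _ ei).
Qed.

Lemma trans_cvg i j s t : 0 <= s -> 0 <= t ->
  \sum_(k < n) p i k s * p k j t @[n --> \oo] --> p i j (s + t).
Proof.
move=> s0 t0; have [tf _ _] := p_process.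
have := trans_semigroup tf i j s0 t0.
move/(@nneseries_cvg _ (fun k => p i k s * p k j t) 0%N _ _); under eq_fun do rewrite big_mkord.
by apply=> k _; rewrite mulr_ge0// (trans_ge0 tf).
Qed.

Lemma trans_mass_le i n t : 0 <= t -> \sum_(k < n) p i k t <= 1.
Proof.
move=> t0; have [tf _ _] := p_process.
rewrite -(big_mkord xpredT (fun k => p i k t)); move: n.
by apply/nneseries_leP; [move=> k _; exact: (trans_ge0 tf) | exact: (trans_mass tf)].
Qed.

Lemma bd_semigroup_reflecting : 0 < b 0%N ->
  bd_semigroup (bd_mu a b) a b p (fun=> 0).
Proof.
move=> b00; have [tf rates sym] := p_process.
have e0 : bd_first b = 0%N by rewrite /bd_first gt_eqF.
split.
- by move=> i; rewrite bd_mu_gt0 ?e0// ltW.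
- by rewrite a0.
- by move=> i; rewrite a_gt0.
- by case=> // i; rewrite b_pos.
- by move=> i; rewrite bd_mu_balance// e0.
- by move=> i j t; exact: (trans_ge0 tf).
- by move=> i n t; exact: trans_mass_le.
- by move=> i j; exact: (trans_id tf).
- by move=> i j s t; exact: trans_cvg.
- by move=> i j t; apply: sym; rewrite /bd_E /= e0.
- exact: rates.
- by [].
- by move=> n t t0; rewrite addr0; exact: trans_mass_le.
- by rewrite a0; under eq_fun do rewrite mul0r; exact: cvg_cst.
Qed.

(* 1 - p_00 is subadditive in t, with derivative 0 at the origin. *)
Lemma absorbed t : b 0%N = 0 -> 0 <= t -> p 0%N 0%N t = 1.
Proof.
move=> b00 t0; have [tf rates _] := p_process.
have p1 s : 0 <= s -> p 0%N 0%N s <= 1.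
  by move=> s0; have := trans_mass_le 0 1 s0; rewrite big_ord1.
have p0 s : 0 <= s -> 0 <= p 0%N 0%N s by exact: (trans_ge0 tf).
apply/eqP; rewrite eq_le p1//=.
have half s : 0 <= s -> 1 - p 0%N 0%N s <= 2 * (1 - p 0%N 0%N (s / 2)).
  move=> s0; have s20 : 0 <= s / 2 by rewrite divr_ge0.
  have := @series_ge _ (fun k => p 0%N k (s / 2) * p k 0%N (s / 2)) _ _
    (@trans_cvg 0%N 0%N _ _ s20 s20) 1%N.
  rewrite big_ord1 -splitr => /(_ (fun k => mulr_ge0 (trans_ge0 tf _ _ s20) (trans_ge0 tf _ _ s20))).
  have := p1 _ s20; have := p0 _ s20.
  by move: (p 0%N 0%N s) (p 0%N 0%N (s / 2)) => x y; nra.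
have [->|tn0] := eqVneq t 0; first by rewrite (trans_id tf).
have tp : 0 < t by rewrite lt0r tn0.
have sn0 n : 0 < t / 2 ^+ n by rewrite divr_gt0 ?exprn_gt0.
have iter n : t * ((p 0%N 0%N (t / 2 ^+ n) - p 0%N 0%N 0) / (t / 2 ^+ n)) + 1 <= p 0%N 0%N t.
  rewrite (trans_id tf) /=.
  suff : 1 - p 0%N 0%N t <= 2 ^+ n * (1 - p 0%N 0%N (t / 2 ^+ n)).
    have -> : t * ((p 0%N 0%N (t / 2 ^+ n) - 1) / (t / 2 ^+ n)) =
        - (2 ^+ n * (1 - p 0%N 0%N (t / 2 ^+ n))).
      by field; rewrite !gt_eqF ?exprn_gt0.
    by lra.
  elim: n => [|n IH]; first by rewrite expr0 divr1 mul1r.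
  have -> : t / 2 ^+ n.+1 = t / 2 ^+ n / 2 by rewrite exprSr invfM mulrA.
  by apply: le_trans IH _; rewrite exprSr -mulrA ler_wpM2l ?exprn_ge0// half// ltW.
have sl : t / 2 ^+ n @[n --> \oo] --> 0.
  rewrite -[X in _ --> X](mulr0 t); apply: cvgM; first exact: cvg_cst.
  under eq_fun do rewrite -exprVn.
  by apply: cvg_expr; rewrite ger0_norm ?invf_lt1 ?ltr1n.
have L := (cvg_at_rightP _ _ _).1 (rates 0%N 0%N) _ (conj sn0 sl).
have L' : t * ((p 0%N 0%N (t / 2 ^+ n) - p 0%N 0%N 0) / (t / 2 ^+ n)) + 1
    @[n --> \oo] --> t * bd_rate a b 0 0 + 1.
  by apply: cvgD; [apply: cvgM; [exact: cvg_cst | exact: L] | exact: cvg_cst].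
have -> : (1 : R) = t * bd_rate a b 0 0 + 1.
  by rewrite /bd_rate /= a0 b00 addr0 oppr0 mulr0 add0r.
by apply: (cvgr_to_le L'); apply: nearW => n; exact: iter.
Qed.

Lemma absorbed0 j t : b 0%N = 0 -> 0 <= t -> p 0%N j.+1 t = 0.
Proof.
move=> b00 t0; have [tf _ _] := p_process.
apply/eqP; rewrite eq_le (trans_ge0 tf)// andbT.
have := trans_mass_le 0 j.+2 t0.
rewrite big_ord_recl big_ord_recr /= absorbed// gerDl.
apply: le_trans; rewrite lerDr sumr_ge0// => k _.
exact: (trans_ge0 tf).
Qed.

(** State 0 becomes the cemetery: indices shift by one, and p_10 is the probability of having been
    killed, with rate a_1. *)
Lemma bd_semigroup_absorbing : b 0%N = 0 ->
  bd_semigroup (fun i => bd_mu a b i.+1) (fun i => a i.+1) (fun i => b i.+1)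
    (fun i j => p i.+1 j.+1) (p 1 0).
Proof.
move=> b00; have [tf rates sym] := p_process.
have e1 : bd_first b = 1%N by rewrite /bd_first b00 eqxx.
have mass i n t : 0 <= t -> \sum_(j < n) p i j.+1 t + p i 0%N t <= 1.
  move=> t0; have := trans_mass_le i n.+1 t0.
  by rewrite big_ord_recl /= addrC.
split.
- by move=> i; rewrite bd_mu_gt0 ?e1 ?b00.
- by rewrite ltW ?a_gt0.
- by move=> i; rewrite a_gt0.
- by move=> i; rewrite b_pos.
- by move=> i; rewrite bd_mu_balance// e1.
- by move=> i j t; exact: (trans_ge0 tf).
- move=> i n t t0; apply: le_trans (mass i.+1 n t t0).
  by rewrite lerDl (trans_ge0 tf).
- by move=> i j; exact: (trans_id tf).
(* The process never leaves 0, so the k = 0 term of Chapman-Kolmogorov vanishes. *)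
- move=> i j s t s0 t0; have := @trans_cvg i.+1 j.+1 _ _ s0 t0.
  rewrite -cvg_shiftS; apply: cvg_trans; apply: near_eq_cvg; apply: nearW => n.
  by rewrite /= big_ord_recl /= absorbed0// mulr0 add0r.
- by move=> i j t; apply: sym; rewrite /bd_E /= e1.
- by move=> i j; have := rates i.+1 j.+1.
- by move=> t; exact: (trans_ge0 tf).
- by move=> n t; exact: mass.
- have := rates 1%N 0%N; rewrite (trans_id tf) /=.
  by under eq_fun do rewrite subr0.
Qed.

End Reduction.

Section SumShift.
Context {R : realType}.
Implicit Types u : nat -> R.

Lemma sum_shift1 u m n : \sum_(m.+1 <= i < n.+1) u i = \sum_(m <= i < n) u i.+1.
Proof. by rewrite big_add1. Qed.

Lemma unbounded_shift1 u : (forall i, (1 <= i)%N -> 0 <= u i) ->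
  (\sum_(1 <= i <oo) (u i)%:E = +oo)%E <-> unbounded_series (fun i => u i.+1).
Proof.
move=> u0; rewrite nneseries_unbounded//; split=> uA A; have [n Hn] := uA A.
  by exists n.-1; move: Hn; rewrite big_add1 big_mkord.
by exists n.+1; rewrite sum_shift1 big_mkord.
Qed.

Lemma unbounded_shift0 u : (forall i, 0 <= u i) ->
  (\sum_(0 <= i <oo) (u i)%:E = +oo)%E <-> unbounded_series u.
Proof.
move=> u0; rewrite nneseries_unbounded//; split=> uA A; have [n Hn] := uA A.
  by exists n; move: Hn; rewrite big_mkord.
by exists n; rewrite big_mkord.
Qed.

End SumShift.

(** * The criterion under absorption and under reflection at 0 *)

Section Assembly.
Context {R : realType}.

Lemma criterion_absorbing (a b : nat -> R) (p : nat -> nat -> R -> R)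
  (a0 : a 0%N = 0) (a_gt0 : forall i, (1 <= i)%N -> 0 < a i)
  (b_pos : forall i, (1 <= i)%N -> 0 < b i) (b00 : b 0%N = 0)
  (mu_b_div : (\sum_(1 <= k <oo)
     ((bd_mu a b k * b k)^-1 + bd_mu a b k)%R%:E = +oo)%E)
  (p_process : bd_process a b p) :
  [/\ (\sum_(1 <= i <oo) (bd_mu a b i)%:E < +oo)%E ->
        (0 < conv_rate (bd_E b) p <-> bd_delta1 a b < +oo)%E,
      (\sum_(1 <= i <oo) (bd_mu a b i)%:E = +oo)%E ->
        (0 < conv_rate (bd_E b) p <-> bd_delta2 a b < +oo)%E &
      ((4%:E * (bd_kappaV_absorbing a b)^-1)^-1 <= conv_rate (bd_E b) p <=
       ((bd_kappaV_absorbing a b)^-1)^-1)%E].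
Proof.
have H := bd_semigroup_absorbing a0 a_gt0 b_pos p_process b00.
have e1 : bd_first b = 1%N by rewrite /bd_first b00 eqxx.
have mu0 n : (1 <= n)%N -> 0 < bd_mu a b n.
  by move=> n1; apply: bd_mu_gt0 => //; rewrite ?b00 ?e1.
have r0 n : (1 <= n)%N -> 0 < (bd_mu a b n * b n)^-1.
  by move=> n1; rewrite invr_gt0 mulr_gt0 ?mu0 ?b_pos.
have s0 n : (1 <= n)%N -> 0 < (bd_mu a b n * a n)^-1.
  by move=> n1; rewrite invr_gt0 mulr_gt0 ?mu0 ?a_gt0.
have tot : unbounded_series (fun k => (bd_mu a b k.+1 * b k.+1)^-1 + bd_mu a b k.+1).
  by apply: ((unbounded_shift1 _).1 mu_b_div) => i i1; rewrite addr_ge0// ltW ?r0 ?mu0.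
pose A n := \sum_(0 <= i < n.+1) (bd_mu a b i.+1 * a i.+1)^-1.
pose w i := bd_mu a b i.+1; pose r i := (bd_mu a b i.+1 * b i.+1)^-1.
have w0 i : 0 < w i by exact: mu0.
have rr0 i : 0 < r i by exact: r0.
pose Y n := \sum_(1 <= i < n.+1) (bd_mu a b i * a i)^-1.
have YA n : Y n.+1 = A n by rewrite /Y sum_shift1.
have A0 n : 0 < A n.
  by rewrite /A big_ltn// ltr_pwDl ?s0// big_nat sumr_ge0// => i _; rewrite ltW// s0.
pose X (nm : nat * nat) := \sum_(nm.1 <= j < nm.2.+1) bd_mu a b j.
pose D : set (nat * nat) := [set nm | (1 <= nm.1 <= nm.2)%N].
have X0 nm : D nm -> 0 < X nm.
  case: nm => n m /andP[/= n1 nm]; rewrite /X /= big_ltn ?ltnS// ltr_pwDl ?mu0//.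
  by rewrite big_nat sumr_ge0// => i /andP[ni _]; rewrite ltW// mu0// (leq_trans _ ni).
have Y0 nm : D nm -> 0 < Y nm.1 by case: nm => [[|n] m] //= _; rewrite YA.
have u0 nm i : D nm -> (nm.2 <= i)%N -> 0 < (bd_mu a b i * b i)^-1.
  by case: nm => n m /andP[/= n1 nm] mi; rewrite r0// (leq_trans n1)// (leq_trans nm).
have kE y : (y%:E <= bd_kappaV_absorbing a b)%E <-> kappa_bound A w r id y.
  rewrite (kappa_ge y X0 Y0 u0); split=> Q.
    move=> n m M nm mM; have := Q (n.+1, m.+1) M.+1.
    by rewrite /X /= !sum_shift1 YA; apply.
  move=> [[|n] [|m]] M //= nm mM; case: M mM => // M mM.
  by rewrite /X /= !sum_shift1 YA; apply: Q.
have Kfin : bd_kappaV_absorbing a b \is a fin_num.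
  by apply: (kappa_fin _ X0 Y0 u0); exists (1, 1)%N.
have rateE : conv_rate (bd_E b) p =
    ereal_sup [set alpha%:E | alpha in decays (fun i j => p i.+1 j.+1)].
  rewrite /conv_rate; congr ereal_sup; congr image.
  apply/seteqP; split=> alpha /= dec.
    by move=> i j; apply: dec; rewrite /bd_E /= e1.
  by case=> [|i] [|j]; rewrite /bd_E /= e1// => _ _; exact: dec.
have Q0 : kappa_bound A w r id 0.
  move=> n m M _ _; rewrite mul0r addr_ge0 ?invr_ge0 ?(ltW (A0 _))//.
  by rewrite sumr_ge0// => i _; exact: ltW.
have a1 : 0 < a 1%N by exact: a_gt0.
have SQ alpha : 0 < alpha -> decays (fun i j => p i.+1 j.+1) alpha ->
    kappa_bound A w r id alpha.
  by move=> alpha0 dec n m M nm mM; apply: (decay_absorbing H a1 alpha0 dec); rewrite nm.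
have QS y lam : 0 < y -> kappa_bound A w r id y -> 0 <= lam -> lam < y / 4 ->
    decays (fun i j => p i.+1 j.+1) lam.
  exact: (decays_absorbing H tot).
have [iff bnd] := rate_bounds Kfin kE Q0 (decays0 H) SQ QS.
rewrite rateE; split => // [muf|muy].
  have rinf : unbounded_series r.
    have [[S rS]|//] := series_dichotomy (fun k => ltW (rr0 k)).
    have [||S' wS'] := @nneseries_fin _ (bd_mu a b) 1; [by move=> i /mu0/ltW|by []|].
    have := nneseries_cvg _ wS' => /(_ (fun i i1 => ltW (mu0 i i1))).
    rewrite -cvg_shiftS; under eq_fun do rewrite sum_shift1 big_mkord.
    by move=> wS; have := total_unbounded_or H tot rS wS.
  rewrite iff (kappa_bound_one_sided _ A0 w0 rr0 rinf).
  rewrite (@delta_fin _ _ Y (bd_mu a b)); first last.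
  - by move=> n i n1 ni; rewrite ltW// mu0// (leq_trans n1).
  - by case=> // n _; rewrite YA.
  split=> -[C HC]; exists C.
    (* For N = 0 the sum is empty, and C >= 0 is read off another empty sum. *)
    case=> [|n] [|N] // _; first by rewrite big_geq// mulr0; have := HC 0%N 0%N; rewrite big_geq// mulr0.
    by rewrite YA sum_shift1; exact: HC.
  by move=> n N; have := HC n.+1 N.+1; rewrite YA sum_shift1; exact.
have winf : unbounded_series w.
  by apply: ((unbounded_shift1 _).1 muy) => i /mu0/ltW.
rewrite iff (kappa_bound_unbounded _ A0 w0 rr0 winf).
rewrite /bd_delta2 e1 (@delta_fin _ _ (fun n => \sum_(1 <= i < n.+1) bd_mu a b i)
  (fun j => (bd_mu a b j * b j)^-1)); first last.
- by move=> n i; rewrite /bd_E /= e1 => n1 ni; rewrite ltW// r0// (leq_trans n1).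
- move=> n; rewrite /bd_E /= e1 => n1; rewrite big_ltn// ltr_pwDl ?mu0//.
  by rewrite big_nat sumr_ge0// => i /andP[i2 _]; rewrite ltW// mu0// ltnW.
split=> -[C HC]; exists C.
  case=> [|n] N; rewrite /bd_E /= e1// => _; rewrite sum_shift1.
  case: N => [|N]; last by rewrite sum_shift1; exact: HC.
  by rewrite [X in _ * X]big_geq// mulr0; have := HC 0%N 0%N; rewrite [X in _ * X]big_geq// mulr0.
move=> m N; have := HC m.+1 N.+1; rewrite /bd_E /= e1 !sum_shift1; exact.
Qed.

Lemma criterion_reflecting (a b : nat -> R) (p : nat -> nat -> R -> R)
  (a0 : a 0%N = 0) (a_gt0 : forall i, (1 <= i)%N -> 0 < a i)
  (b_pos : forall i, (1 <= i)%N -> 0 < b i) (b00 : 0 < b 0%N)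
  (mu_b_div : (\sum_(0 <= k <oo)
     ((bd_mu a b k * b k)^-1 + bd_mu a b k)%R%:E = +oo)%E)
  (p_process : bd_process a b p) :
  [/\ (\sum_(0 <= i <oo) (bd_mu a b i)%:E < +oo)%E ->
        (0 < conv_rate (bd_E b) p <-> bd_delta1 a b < +oo)%E,
      (\sum_(0 <= i <oo) (bd_mu a b i)%:E = +oo)%E ->
        (0 < conv_rate (bd_E b) p <-> bd_delta2 a b < +oo)%E &
      ((4%:E * (bd_kappaV_reflecting a b)^-1)^-1 <= conv_rate (bd_E b) p <=
       ((bd_kappaV_reflecting a b)^-1)^-1)%E].
Proof.
have H := bd_semigroup_reflecting a0 a_gt0 b_pos p_process b00.
have e0 : bd_first b = 0%N by rewrite /bd_first gt_eqF.
pose w := bd_mu a b; pose r i := (bd_mu a b i * b i)^-1.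
have w0 i : 0 < w i by exact: (w_gt0 H).
have r0 i : 0 < r i by rewrite invr_gt0 mulr_gt0 ?(b_gt0 H)//; exact: w0.
have tot : unbounded_series (fun k => (bd_mu a b k * b k)^-1 + bd_mu a b k).
  by apply: ((unbounded_shift0 _).1 mu_b_div) => i; apply: addr_ge0; apply: ltW;
    [exact: r0|exact: w0].
pose A n := \sum_(0 <= i < n.+1) w i.
have A0 n : 0 < A n.
  by rewrite /A big_ltn// ltr_pwDl// sumr_ge0// => i _; exact: ltW.
pose X (nm : nat * nat) := \sum_(nm.1 <= j < nm.2) r j.
pose D : set (nat * nat) := [set nm | (0 <= nm.1 < nm.2)%N].
have X0 nm : D nm -> 0 < X nm.
  case: nm => n m /andP[/= _ nm]; rewrite /X /= big_ltn// ltr_pwDl//.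
  by rewrite sumr_ge0// => i _; exact: ltW.
have Y0 nm : D nm -> 0 < A nm.1 by [].
have u0 (nm : nat * nat) i : D nm -> (nm.2 <= i)%N -> 0 < w i by [].
have kE y : (y%:E <= bd_kappaV_reflecting a b)%E <-> kappa_bound A r w succn y.
  rewrite (kappa_ge y X0 Y0 u0); split=> Q.
    by move=> n m M nm mM; exact: (Q (n, m.+1) M).
  move=> [n [|m]] M //= nm mM.
  exact: Q.
have Kfin : bd_kappaV_reflecting a b \is a fin_num.
  by apply: (kappa_fin _ X0 Y0 u0); exists (0, 1)%N.
have rateE : conv_rate (bd_E b) p = ereal_sup [set alpha%:E | alpha in decays p].
  rewrite /conv_rate; congr ereal_sup; congr image.
  apply/seteqP; split=> alpha /= dec.
    by move=> i j; apply: dec; rewrite /bd_E /= e0.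
  by move=> i j _ _; exact: dec.
have Q0 : kappa_bound A r w succn 0.
  move=> n m M _ _; rewrite mul0r addr_ge0 ?invr_ge0 ?(ltW (A0 _))//.
  by rewrite sumr_ge0// => i _; exact: ltW.
have SQ alpha : 0 < alpha -> decays p alpha -> kappa_bound A r w succn alpha.
  by move=> alpha0 dec n m M nm mM; apply: (decay_reflecting H a0 alpha0 dec); rewrite mM ltnS nm.
have QS y lam : 0 < y -> kappa_bound A r w succn y -> 0 <= lam -> lam < y / 4 ->
    decays p lam.
  exact: (decays_reflecting H tot).
have [iff bnd] := rate_bounds Kfin kE Q0 (decays0 H) SQ QS.
rewrite rateE; split => // [muf|muy].
  have rinf : unbounded_series r.
    have [[S rS]|//] := series_dichotomy (fun k => ltW (r0 k)).
    have [||S' wS'] := @nneseries_fin _ w 0; [by move=> i _; exact: ltW|by []|].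
    have := nneseries_cvg _ wS' => /(_ (fun i _ => ltW (w0 i))).
    under eq_fun do rewrite big_mkord.
    by move=> wS; have := total_unbounded_or H tot rS wS.
  rewrite iff (kappa_bound_unbounded _ A0 r0 w0 rinf).
  (* Detailed balance identifies 1 / (mu_{i+1} a_{i+1}) with 1 / (mu_i b_i); the shift by one
     matches the tail starting at m + 1 in the reflecting kappa. *)
  have Yr n : \sum_(1 <= i < n.+2) (bd_mu a b i * a i)^-1 = \sum_(0 <= i < n.+1) r i.
    by rewrite sum_shift1; apply: eq_bigr => i _; rewrite (w_balance H).
  rewrite (@delta_fin _ _ (fun n => \sum_(1 <= i < n.+1) (bd_mu a b i * a i)^-1) w);
    first last.
  - by move=> n i _ _; exact: ltW.
  - by case=> // n _; rewrite Yr big_ltn// ltr_pwDl// sumr_ge0// => i _; exact: ltW.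
  split=> -[C HC]; exists C.
    by case=> // n N _; rewrite Yr; exact: HC.
  by move=> m N; have := HC m.+1 N; rewrite Yr; exact.
have winf : unbounded_series w.
  by apply: ((unbounded_shift0 _).1 muy) => i; exact: ltW.
rewrite iff (kappa_bound_one_sided _ A0 r0 w0 winf).
rewrite /bd_delta2 e0 (@delta_fin _ _ A r); first last.
- by move=> n i _ _; exact: ltW.
- by [].
split=> -[C HC]; exists C => n N; first by move=> _; exact: HC.
by apply: HC; rewrite /bd_E /= e0.
Qed.

End Assembly.

Local Close Scope ring_scope.
Local Close Scope classical_set_scope.
Local Open Scope ereal_scope.

Theorem theorem1p5 (R : realType) (a b : nat -> R) (p : nat -> nat -> R -> R)
  (a0 : a 0%N = 0%R)
  (b0_ge0 : (0 <= b 0%N)%R)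
  (a_gt0 : forall i, (1 <= i)%N -> (0 < a i)%R)
  (b_gt0 : forall i, (1 <= i)%N -> (0 < b i)%R)
  (mu_b_div : \sum_(bd_first b <= k <oo)
     ((bd_mu a b k * b k)^-1 + bd_mu a b k)%R%:E = +oo)
  (p_process : bd_process a b p) :
  [/\ \sum_(bd_first b <= i <oo) (bd_mu a b i)%:E < +oo ->
        (0 < conv_rate (bd_E b) p <-> bd_delta1 a b < +oo),
      \sum_(bd_first b <= i <oo) (bd_mu a b i)%:E = +oo ->
        (0 < conv_rate (bd_E b) p <-> bd_delta2 a b < +oo) &
      (4%:E * bd_kappa a b)^-1 <= conv_rate (bd_E b) p <= (bd_kappa a b)^-1].
Proof.
rewrite /bd_kappa; have [b00|b00] := eqVneq (b 0%N) 0%R.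
  have e1 : bd_first b = 1%N by rewrite /bd_first b00 eqxx.
  rewrite e1 in mu_b_div *.
  exact: criterion_absorbing.
have e0 : bd_first b = 0%N by rewrite /bd_first (negbTE b00).
rewrite e0 in mu_b_div *.
by apply: criterion_reflecting => //; rewrite lt0r b00.
Qed.
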